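(* Assume that $f(x,a,b)=f_1(x,a)+f_2(x,b)$ for all $(x,a,b)\in\mathbb{R}^d\times A\times B$, for some Lipschitz continuous functions $f_1:\mathbb{R}^d\times A\to\mathbb{R}^d$ and $f_2:\mathbb{R}^d\times B\to\mathbb{R}^d$. Assume furthermore that $f_1(x,A)$ and $f_2(x,B)$ are convex for all $x\in\mathbb{R}^d$. Consider the Euler scheme $F(x,a,b)=x+\tau f(x,a,b)$ with $\tau=T/N$. Then there exists a constant $C\ge0$, independent of $N$, such that for all $x\in\mathbb{R}^d$, $$|v_0(x)-V_0(x)|\le C(1+|x|)\,\tau.$$
   Context: Let $T>0$ and $N\ge1$. $A\subset\mathbb{R}^{n_A}$ and $B\subset\mathbb{R}^{n_B}$ ($n_A,n_B\ge1$) are non-empty compact sets; $f:\mathbb{R}^d\times A\times B\to\mathbb{R}^d$, $g:\mathbb{R}^d\to\mathbb{R}$ and $\varphi:\mathbb{R}^d\to\mathbb{R}$ are Lipschitz continuous. Write $p\vee q=\max(p,q)$; $|\cdot|$ is a norm on $\mathbb{R}^d$. Continuous value. $\mathcal{A}_T$ (resp. $\mathcal{B}_T$) is the set of measurable functions $(0,T)\to A$ (resp. $(0,T)\to B$). $\Gamma_{(0,T)}$ is the set of non-anticipative strategies, i.e. functions $\alpha:\mathcal{B}_T\to\mathcal{A}_T$ such that for all $t\in[0,T]$, if $b,\bar b\in\mathcal{B}_T$ coincide (a.e.) on $[0,t]$ then $\alpha[b],\alpha[\bar b]$ coincide (a.e.) on $[0,t]$. For $a\in\mathcal{A}_T,b\in\mathcal{B}_T$,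 $y^{a,b}_{0,x}$ is the unique Carathéodory solution of $\dot y(s)=f(y(s),a(s),b(s))$ for a.e. $s\in(0,T)$, $y(0)=x$. Define $$v_0(x)=\inf_{\alpha\in\Gamma_{(0,T)}}\sup_{b\in\mathcal{B}_T}\Big(\max_{s\in(0,T)}g(y^{\alpha[b],b}_{0,x}(s))\Big)\vee\varphi(y^{\alpha[b],b}_{0,x}(T)),$$ where the max over $(0,T)$ is understood as a supremum. Semi-discrete value. For $a\in A^N$, $b\in B^N$, let $X^{a,b}_{0,x}=x$, $X^{a,b}_{k+1,x}=F(X^{a,b}_{k,x},a_k,b_k)$ and $J_0(x,a,b)=\big(\max_{0\le k\le N-1}g(X^{a,b}_{k,x})\big)\vee\varphi(X^{a,b}_{N,x})$. $S_N$ is the set of discrete non-anticipative strategies: measurable functions $\alpha:B^N\to A^N$ such that for every $0\le k\le N-1$ the component $\alpha_k$ depends only on $(b_0,\dots,b_k)$. Define $V_0(x)=\inf_{\alpha\in S_N}\sup_{b\in B^N}J_0(x,\alpha[b],b)$. *)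

(* Defs.v *)
From HB Require Import structures.
From mathcomp Require Import all_boot all_order all_algebra.
From mathcomp Require Import all_classical all_reals all_analysis.
From mathcomp Require Import measurable_realfun.

Set Implicit Arguments.
Unset Strict Implicit.
Unset Printing Implicit Defensive.

Import Order.TTheory GRing.Theory Num.Theory.
Import numFieldNormedType.Exports.

Local Open Scope classical_set_scope.
Local Open Scope ring_scope.

(* The library norm on 'rV[R]_n is the sup norm; [is_norm] describes an
   arbitrary norm on R^n. *)
Definition is_norm (R : realType) (n : nat) (p : 'rV[R]_n -> R) :=
  [/\ forall x y, p (x + y) <= p x + p y,
      forall (c : R) x, p (c *: x) = `|c| * p x
    & forall x, p x = 0 -> x = 0].

Definition borel_rV (R : realType) (n : nat) :=
  g_sigma_algebraType (@open 'rV[R]_n).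

(* R with the sigma-algebra of Lebesgue measurable sets (the canonical
   measurable structure of the library on R is the Borel one). *)
Definition lebesgueR (R : realType) :=
  g_sigma_algebraType (completed_algebra_gen (@lebesgue_measure R)).

Section continuous_value.
Context {R : realType} {d nA nB : nat}.
Local Notation mu := (@lebesgue_measure R).

(* Functions on (0,T) are represented by functions on R whose values outside
   (0,T) are irrelevant. *)
Definition controls (n : nat) (U : set 'rV[R]_n) (T : R) : set (R -> 'rV[R]_n) :=
  [set u | (forall s, 0 < s < T -> U (u s)) /\
           measurable_fun (`]0, T[%classic : set (lebesgueR R))
             (u : lebesgueR R -> borel_rV R n)].

Definition ae_eq_on (n : nat) (t : R) (u v : R -> 'rV[R]_n) :=
  {ae mu, forall s, 0 <= s <= t -> u s = v s}.

Definition strategies (A : set 'rV[R]_nA) (B : set 'rV[R]_nB) (T : R) :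
    set ((R -> 'rV[R]_nB) -> (R -> 'rV[R]_nA)) :=
  [set alpha |
    (forall b, controls B T b -> controls A T (alpha b)) /\
    (forall t, 0 <= t <= T -> forall b b', controls B T b -> controls B T b' ->
       ae_eq_on t b b' -> ae_eq_on t (alpha b) (alpha b'))].

Definition abs_continuous (p q : R) (y : R -> 'rV[R]_d) :=
  forall e : R, 0 < e -> exists2 dl : R, 0 < dl &
    forall (m : nat) (s t : 'I_m -> R),
      (forall i, p <= s i /\ s i <= t i /\ t i <= q) ->
      trivIset setT (fun i => `]s i, t i[%classic) ->
      \sum_(i < m) (t i - s i) < dl ->
      \sum_(i < m) `|y (t i) - y (s i)| < e.

Variable f : 'rV[R]_d -> 'rV[R]_nA -> 'rV[R]_nB -> 'rV[R]_d.

Definition caratheodory_solution (T : R) (a : R -> 'rV[R]_nA)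
    (b : R -> 'rV[R]_nB) (x : 'rV[R]_d) (y : R -> 'rV[R]_d) :=
  [/\ y 0 = x,
      abs_continuous 0 T y
    & {ae mu, forall s, 0 < s < T ->
        is_derive s (1 : R) y (f (y s) (a s) (b s))}].

(* The solution is unique only on [0,T]; [payoff] does not look outside. *)
Definition trajectory (T : R) (a : R -> 'rV[R]_nA) (b : R -> 'rV[R]_nB)
    (x : 'rV[R]_d) : R -> 'rV[R]_d :=
  xget (cst x) [set y | caratheodory_solution T a b x y].

Variables g phi : 'rV[R]_d -> R.

Definition payoff (T : R) (y : R -> 'rV[R]_d) : \bar R :=
  maxe (ereal_sup [set (g (y s))%:E | s in `]0, T[%classic]) (phi (y T))%:E.

Definition value (A : set 'rV[R]_nA) (B : set 'rV[R]_nB) (T : R)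
    (x : 'rV[R]_d) : \bar R :=
  ereal_inf [set ereal_sup [set payoff T (trajectory T (alpha b) b x)
                           | b in controls B T]
            | alpha in strategies A B T].

End continuous_value.

Section discrete_value.
Context {R : realType} {d nA nB : nat}.

Definition dcontrols (n : nat) (U : set 'rV[R]_n) (N : nat) :
    set (N.-tuple 'rV[R]_n) :=
  [set u | forall k, U (tnth u k)].

(* Measurability is with respect to the product sigma-algebras on tuples. *)
Definition dstrategies (A : set 'rV[R]_nA) (B : set 'rV[R]_nB) (N : nat) :
    set (N.-tuple 'rV[R]_nB -> N.-tuple 'rV[R]_nA) :=
  [set alpha |
    [/\ forall b, dcontrols B b -> dcontrols A (alpha b),
        measurable_fun (dcontrols B (N := N) : set (N.-tuple (borel_rV R nB)))
          (alpha : N.-tuple (borel_rV R nB) -> N.-tuple (borel_rV R nA))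
      & forall (k : 'I_N) b b', dcontrols B b -> dcontrols B b' ->
          (forall i : 'I_N, (i <= k)%N -> tnth b i = tnth b' i) ->
          tnth (alpha b) k = tnth (alpha b') k]].

Variable F : 'rV[R]_d -> 'rV[R]_nA -> 'rV[R]_nB -> 'rV[R]_d.

Fixpoint dtrajectory (x : 'rV[R]_d) (a : seq 'rV[R]_nA) (b : seq 'rV[R]_nB)
    (k : nat) : 'rV[R]_d :=
  if k is k'.+1 then F (dtrajectory x a b k') (nth 0 a k') (nth 0 b k') else x.

Variables g phi : 'rV[R]_d -> R.

Definition dpayoff (N : nat) (x : 'rV[R]_d) (a : N.-tuple 'rV[R]_nA)
    (b : N.-tuple 'rV[R]_nB) : \bar R :=
  maxe (\big[maxe/-oo%E]_(k < N) (g (dtrajectory x a b k))%:E)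
       (phi (dtrajectory x a b N))%:E.

Definition dvalue (A : set 'rV[R]_nA) (B : set 'rV[R]_nB) (N : nat)
    (x : 'rV[R]_d) : \bar R :=
  ereal_inf [set ereal_sup [set dpayoff x (alpha b) b | b in dcontrols B (N := N)]
            | alpha in dstrategies A B (N := N)].

End discrete_value.

(* Main.v *)
Require Import Defs.
From HB Require Import structures.
From mathcomp Require Import all_boot all_order all_algebra.
From mathcomp Require Import all_classical all_reals all_analysis.
From mathcomp Require Import measurable_realfun ring lra.
Import Order.TTheory GRing.Theory Num.Theory.
Import numFieldNormedType.Exports.
Local Open Scope classical_set_scope.
Local Open Scope ring_scope.

Set Implicit Arguments.
Unset Strict Implicit.
Unset Printing Implicit Defensive.

(* Each kind of strategy is turned into the other with an error O(tau).

   A continuous strategy is fed with piecewise constant controls b; on a time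
   step the velocity of the trajectory y stays O(tau)-close to the convex set
   f1(y(t_k), A) + f2(y(t_k), b_k), hence so does the mean velocity, which
   provides the discrete answer a_k.  Rounding b_k to a finite net of B makes
   the discrete strategy finitely valued, hence measurable.

   A discrete strategy is played with a delay of one step, a(s) = a_{k-1} on
   [t_k, t_{k+1}[, and the b_k that it is fed with are chosen in the same way
   from the mean velocity.  As f is a sum of a function of a and a function of
   b, w_k = y(t_k) + tau f1(y(t_k), a_{k-1}) is a perturbed Euler scheme for
   (a_k, b_k).  Both comparisons end with a discrete Gronwall lemma.

   No integral of the dynamics is needed: an absolutely continuous function is
   controlled by its a.e. derivative through a Cousin partition, and
   primitives are obtained from Lebesgue differentiation of indicators by
   finite sums and uniform limits. *)

(** * Absolute continuity and a.e. derivatives *)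

(** The obstacle is information. Against a piecewise constant control, [b_0], ..., [b_k] fix the
    trajectory up to [t_{k+1}] by non-anticipativity, so [a_k] may be read off from [y(t_{k+1})] and
    still be a legal discrete answer. In the other direction [b_k] is extracted from what happened
    during the step and is known only at [t_{k+1}], too late for [a_k] to act on that step: hence
    the delay, and the splitting of [f], which lets [a_k] and [b_k] be paired again although they
    act on different steps. Convexity turns a mean velocity into a velocity attained by one constant
    control. A local error of order [tau^2] over [N] steps leaves order [tau]; the factor [1 + |x|]
    comes from the bound on the speed. Selections are made by [xget] from values of trajectories,
    which depend on the controls only up to null sets. *)

Section almost_everywhere.
Context {R : realType}.
Local Notation mu := (@lebesgue_measure R).
Implicit Types P Q : R -> Prop.

Lemma ae_imply P Q : (forall s, P s -> Q s) ->
  {ae mu, forall s, P s} -> {ae mu, forall s, Q s}.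
Proof. by move=> PQ [N [mN N0 PN]]; exists N; split => // s /= nQ; apply: PN => /PQ. Qed.

Lemma ae_conj P Q : {ae mu, forall s, P s} -> {ae mu, forall s, Q s} ->
  {ae mu, forall s, P s /\ Q s}.
Proof. by move=> aeP aeQ; exact: (@filterI _ _ (ae_filter_ringOfSetsType mu)). Qed.

Lemma ae_neq (z : R) : {ae mu, forall s, s != z}.
Proof.
exists [set z]; split; [exact: measurable_set1|exact: lebesgue_measure_set1|].
by move=> s /= /negP; rewrite negbK => /eqP.
Qed.

End almost_everywhere.

(** Cousin's lemma as an induction principle on intervals: [P] can carry whatever data accumulate
    along a partition. The supremum of the points reachable from [p] is pushed beyond itself by its
    own gauge, unless it is [q]. *)
Lemma cousin {R : realType} (P : R -> R -> Prop) (p q : R) : p <= q ->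
  (forall u v w, p <= u -> u <= v -> v <= w -> w <= q ->
     P u v -> P v w -> P u w) ->
  (forall s, p <= s <= q -> exists2 e, 0 < e &
     forall u v, p <= u -> u <= s -> s <= v -> v <= q ->
       s - u < e -> v - s < e -> P u v) ->
  P p q.
Proof.
move=> pq Pcat Ploc.
pose E := [set t | p <= t <= q /\ P p t].
have Ep : E p.
  split; first by rewrite lexx pq.
  have [|e e0 He] := Ploc p; first by rewrite lexx pq.
  by apply: He => //; rewrite subrr.
have hE : has_sup E.
  by split; [exists p|exists q => t [/andP[]]].
pose c := sup E.
have cE t : E t -> t <= c by move=> Et; exact: ub_le_sup hE.2 _ Et.
have pc : p <= c by exact: cE.
have cq : c <= q by apply: ge_sup hE.1 _ => t [/andP[]].
have [|e e0 He] := Ploc c; first by rewrite pc cq.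
have [t [/andP[pt tq] Pt] ct] := sup_adherent e0 hE; rewrite -/c in ct.
have tc : t <= c by apply: cE; split => //; rewrite pt tq.
pose v := Num.min q (c + e / 2).
have vq : v <= q by rewrite ge_min lexx.
have cv : c <= v by rewrite le_min cq lerDl divr_ge0 // ltW.
have Pv : P p v.
  apply: (Pcat p t v) => //; first exact: le_trans tc cv.
  apply: He => //; first by rewrite ltrBlDl addrC -ltrBlDl.
  rewrite ltrBlDl (@le_lt_trans _ _ (c + e / 2)) ?ge_min ?lexx ?orbT //.
  by rewrite ltrD2l; lra.
have vc : v <= c by apply: cE; split => //; rewrite vq (le_trans pc cv).
have [qc|qc] := leP q (c + e / 2).
  by rewrite /v min_l // in Pv.
by move: vc; rewrite /v min_r ?(ltW qc) //; lra.
Qed.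

Section absolute_continuity.
Context {R : realType} {d : nat}.
Local Notation mu := (@lebesgue_measure R).
Implicit Types (y : R -> 'rV[R]_d).

(** Ordered lists are what the concatenation of Cousin pieces produces; the order yields the
    disjointness that the definition asks for. *)
Lemma abs_continuous_seq (p q : R) y (e : R) : abs_continuous p q y -> 0 < e ->
  exists2 dl : R, 0 < dl & forall l : seq (R * R),
    (forall i, i \in l -> [/\ p <= i.1, i.1 <= i.2 & i.2 <= q]) ->
    pairwise (fun i j => i.2 <= j.1) l ->
    \sum_(i <- l) (i.2 - i.1) < dl ->
    \sum_(i <- l) `|y i.2 - y i.1| < e.
Proof.
move=> yac e0; have [dl dl0 H] := yac e e0; exists dl => // l lpq lpw.
rewrite !(big_nth (0, 0)) !big_mkord => ldl.
apply: (H _ (fun i => (nth (0, 0) l i).1) (fun i => (nth (0, 0) l i).2)) => //.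
- by move=> i; have [] := lpq (nth (0, 0) l i) (mem_nth _ (ltn_ord i)).
- have dis (i j : 'I_(size l)) (x : R) : (i < j)%N ->
    (nth (0, 0) l i).1 < x < (nth (0, 0) l i).2 ->
    (nth (0, 0) l j).1 < x < (nth (0, 0) l j).2 -> False.
    move=> ij; move/(pairwiseP (0, 0)): lpw => /(_ i j (ltn_ord i) (ltn_ord j) ij) /=.
    move=> h /andP[a1 a2] /andP[a3 a4].
    by move: (lt_trans a3 (lt_le_trans a2 h)); rewrite ltxx.
  apply/trivIsetP => i j _ _ ij; rewrite -subset0 => x [/=].
  rewrite !in_itv /= => xi xj.
  have [ltij|ltji|/val_inj/eqP] := ltngtP i j; last by rewrite (negbTE ij).
    exact: dis ltij xi xj.
  exact: dis ltji xj xi.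
Qed.

(** Cover the exceptional null set by an open [U] of measure below [dl] and let [m t] be the measure
    of [U] to the left of [t]. Intervals around bad tags lie in [U], so increments of [m] bound
    their lengths; these increments telescope, which keeps the total length below [dl]. *)
Lemma ae_nbhs_gauge (P : R -> Prop) (dl : R) : {ae mu, forall s, P s} -> 0 < dl ->
  exists m : R -> R, [/\ {homo m : u v / u <= v},
    forall u v, m v - m u < dl
  & forall s, ~ P s -> exists2 e, 0 < e &
      forall u v, u <= s -> s <= v -> s - u < e -> v - s < e -> v - u <= m v - m u].
Proof.
move=> [N [mN N0 PN]] dl0.
have [|U [oU NU UN]] := lebesgue_regularity_outer mN _ dl0.
  by rewrite -[ltLHS]/(mu N) N0 ltry.
have mU : measurable U by exact: open_measurable.
have muU : (mu U < dl%:E)%E.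
  have -> : mu U = mu (U `\` N); last exact: UN.
  have muUN : mu (U `&` N) = 0%E.
    apply/eqP; rewrite eq_le measure_ge0 andbT -[leRHS]N0.
    by apply: le_measure; rewrite ?inE//; exact: measurableI.
  have -> : mu U = (mu (U `\` N) + mu (U `&` N))%E by exact: measureDI.
  by rewrite muUN adde0.
have mI t : measurable (U `&` `]-oo, t]) by apply: measurableI => //; exact: measurable_itv.
have leU t : (mu (U `&` `]-oo, t]) <= mu U)%E.
  apply: le_measure; rewrite ?inE//; exact: mI.
have fin t : mu (U `&` `]-oo, t]) \is a fin_num.
  by rewrite ge0_fin_numE// (le_lt_trans (leU t))// (lt_trans muU) ?ltry.
have finU : mu U \is a fin_num by rewrite ge0_fin_numE// (lt_trans muU) ?ltry.
exists (fun t => fine (mu (U `&` `]-oo, t]))); split.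
- move=> u v uv; apply: fine_le => //; apply: le_measure; rewrite ?inE//; try exact: mI.
  by apply: setIS; apply: subset_itvl; rewrite bnd_simp.
- move=> u v.
  have a : 0 <= fine (mu (U `&` `]-oo, u])) by rewrite fine_ge0.
  have b : fine (mu (U `&` `]-oo, v])) <= fine (mu U) by apply: fine_le.
  have c : fine (mu U) < dl by rewrite -lte_fin fineK.
  lra.
- move=> s nPs.
  have : nbhs s U by apply: open_nbhs_nbhs; split => //; apply/NU/PN.
  move=> /nbhs_ballP[e /= e0 eU]; exists e => // u v us sv su vs.
  have [vu|uv] := leP v u.
    rewrite (_ : u = v) ?subrr//; apply/eqP.
    by rewrite eq_le vu (le_trans us sv).
  have E : U `&` `]-oo, v] = (U `&` `]-oo, u]) `|` `]u, v].
    apply/seteqP; split=> x /=; rewrite !in_itv/=.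
      by move=> [Ux xv]; have [xu|ux] := leP x u; [left|right; rewrite xv].
    move=> [[Ux xu]|/andP[ux xv]]; first by split => //; exact: le_trans xu (ltW uv).
    split => //; apply: eU; rewrite /ball/= ltr_norml.
    lra.
  have mE : mu (U `&` `]-oo, v]) = (mu (U `&` `]-oo, u]) + (v - u)%:E)%E.
    rewrite E measureU//=; last first.
    - by rewrite -subset0 => x [[_ /=]]; rewrite !in_itv/=; lra.
    - exact: mI.
    by congr (_ + _)%E; rewrite lebesgue_measure_itv /= lte_fin uv.
  by rewrite mE fineD//= addrAC subrr add0r.
Qed.

End absolute_continuity.

(** Free of quotients, this form also covers [t = s] and can be applied at both ends of an interval
    around a tag. *)
Lemma is_derive_gaugeP {R : realType} {W : normedModType R} (y : R -> W) (s : R) (dy : W) :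
  is_derive s (1 : R) y dy <->
  forall eps : R, 0 < eps -> exists2 e, 0 < e & forall t, `|t - s| < e ->
    `|y t - y s - (t - s) *: dy| <= eps * `|t - s|.
Proof.
split=> [[ds vs] eps eps0|H].
  have : (fun h : R => h^-1 *: (y (h *: (1 : R) + s) - y s)) @ 0^' --> dy.
    by rewrite -vs; exact: ds.
  move=> /cvgrPdist_le /(_ eps eps0).
  move=> /nbhs_ballP [e /= e0 He]; exists e => // t te.
  have [->|ts] := eqVneq t s.
    by rewrite !subrr scale0r subr0 !normr0 mulr0.
  have ts0 : t - s != 0 by rewrite subr_eq0.
  have := He (t - s); rewrite /ball /= sub0r normrN => /(_ te ts0).
  rewrite [(t - s) *: (1 : R)]mulr1 subrK => H.
  have -> : y t - y s - (t - s) *: dy =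
      (t - s) *: ((t - s)^-1 *: (y t - y s) - dy).
    by rewrite scalerBr scalerA divff// scale1r.
  by rewrite normrZ mulrC ler_wpM2r// distrC.
have cv : (fun h : R => h^-1 *: (y (h *: (1 : R) + s) - y s)) @ 0^' --> dy.
  apply/cvgrPdist_le => eps eps0; have [e e0 He] := H _ eps0.
  near=> h.
  have h0 : h != 0 by near: h; exact: nbhs_dnbhs_neq.
  rewrite [h *: (1 : R)]mulr1 distrC.
  have := He (h + s); rewrite addrK => He'.
  have he : `|h| < e by near: h; exact: dnbhs0_lt.
  have := He' he.
  have -> : y (h + s) - y s - h *: dy = h *: (h^-1 *: (y (h + s) - y s) - dy).
    by rewrite scalerBr scalerA divff// scale1r.
  by rewrite normrZ mulrC ler_pM2r// normr_gt0.
split; first by apply/cvg_ex; exists dy.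
by rewrite /derive; apply/cvg_lim => //; exact: norm_hausdorff.
Unshelve. all: by end_near. Qed.

Section increments.
Context {R : realType} {d : nat}.
Local Notation mu := (@lebesgue_measure R).
Implicit Types (y w : R -> 'rV[R]_d) (p q s t : R).

(* Cousin partition of [p, q]: at tags where the derivative is controlled the
   increment is almost (v - u) times a point of K; the remaining tags are
   covered by intervals of small total length, where absolute continuity
   applies. *)
Lemma increment_in_convex p q y (psi : R -> R) (K : set 'rV[R]_d) (eps : R) :
  p <= q -> abs_continuous p q y ->
  (forall u v, p <= u -> u <= v -> v <= q -> psi u <= psi v) ->
  (forall a b t, K a -> K b -> 0 <= t <= 1 -> K (t *: a + (1 - t) *: b)) ->
  K !=set0 ->
  {ae mu, forall s, p < s < q -> exists dy r k,
     [/\ is_derive s (1 : R) y dy, is_derive s (1 : R) psi r, K k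
       & `|dy - k| <= r]} ->
  0 < eps ->
  exists2 k, K k & `|y q - y p - (q - p) *: k| <= psi q - psi p + eps.
Proof.
move=> pq yac psi_nd Kcvx [k0 Kk0] yK eps0.
(* [eps] is spent in quarters: one on the good tags, one on the variation of [y] over the bad
   intervals, one on [k0] times their total length. The [+ 1] allows [p = q]. *)
pose e1 := eps / (4 * (q - p + 1)).
have qp1 : 0 < q - p + 1 by lra.
have e10 : 0 < e1 by rewrite divr_gt0// mulr_gt0.
have e1qp : e1 * (q - p) <= eps / 4.
  rewrite /e1 mulrAC ler_pdivrMr ?mulr_gt0//.
  have -> : eps / 4 * (4 * (q - p + 1)) = eps * (q - p + 1) by field.
  by rewrite ler_pM2l//; lra.
have eps4 : 0 < eps / 4 by rewrite divr_gt0.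
have [dl1 dl10 Hac] := abs_continuous_seq yac eps4.
have k01 : 0 < 1 + `|k0| by rewrite ltr_pwDl.
pose dl := Num.min dl1 (eps / 4 / (1 + `|k0|)).
have dl0 : 0 < dl by rewrite lt_min dl10 divr_gt0.
have dlk0 : `|k0| * dl <= eps / 4.
  have : dl <= eps / 4 / (1 + `|k0|) by rewrite ge_min lexx orbT.
  rewrite ler_pdivlMr// mulrC; apply: le_trans; rewrite ler_wpM2r ?(ltW dl0)//.
  by rewrite lerDr.
(* The endpoints are turned into bad tags, since the derivative is only controlled inside the
   interval. *)
have good :
    {ae mu, forall s, [/\ s != p, s != q & p < s < q -> exists dy r k,
      [/\ is_derive s (1 : R) y dy, is_derive s (1 : R) psi r, K k
        & `|dy - k| <= r]]}.
  apply: ae_imply (ae_conj (ae_neq p) (ae_conj (ae_neq q) yK)).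
  by move=> s [? []].
have [m [m_nd m_dl m_bad]] := ae_nbhs_gauge good dl0.
(* Absolute continuity bounds all bad intervals together, not each one, so they are collected in [l]
   and estimated once at the end. Each of them is assigned the default point [k0] of [K]. *)
pose P u v := exists (l : seq (R * R)) k,
  [/\ forall i, i \in l -> [/\ u <= i.1, i.1 <= i.2 & i.2 <= v],
      pairwise (fun i j : R * R => i.2 <= j.1) l,
      \sum_(i <- l) (i.2 - i.1) <= m v - m u,
      K k &
      `|y v - y u - (v - u) *: k| <= psi v - psi u + e1 * (v - u) +
        \sum_(i <- l) (`|y i.2 - y i.1| + `|k0| * (i.2 - i.1))].
have : P p q.
  apply: cousin => //.
  - move=> u v w pu uv vw wq [l1 [k1 [H1 pw1 S1 Kk1 E1]]] [l2 [k2 [H2 pw2 S2 Kk2 E2]]].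
    have [uw|wu] := ltP u w; last first.
      exists l1, k1.
      have -> : w = v by apply/eqP; rewrite eq_le vw (le_trans wu uv).
      by split.
    have uw0 : 0 < w - u by rewrite subr_gt0.
    (* The average weighted by lengths: [(w - u) *: k] becomes the sum of [(v - u) *: k1] and
       [(w - v) *: k2]. *)
    exists (l1 ++ l2), (((v - u) / (w - u)) *: k1 + (1 - (v - u) / (w - u)) *: k2).
    split.
    + move=> i; rewrite mem_cat => /orP[/H1[a b c]|/H2[a b c]]; split => //.
        exact: le_trans c vw.
      exact: le_trans uv a.
    + rewrite pairwise_cat pw1 pw2 !andbT; apply/allrelP => i j /H1[_ _ iv] /H2[vj _ _].
      exact: le_trans iv vj.
    + by rewrite big_cat/=; lra.
    + apply: Kcvx => //; rewrite divr_ge0 ?subr_ge0 ?(ltW uw)//=.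
      by rewrite ler_pdivrMr// mul1r; lra.
    + rewrite big_cat/=.
      have -> : y w - y u - (w - u) *: (((v - u) / (w - u)) *: k1 +
                 (1 - (v - u) / (w - u)) *: k2) =
               (y v - y u - (v - u) *: k1) + (y w - y v - (w - v) *: k2).
        rewrite scalerDr !scalerA mulrBr mulr1 mulrCA divff ?gt_eqF// mulr1.
        have -> : w - u - (v - u) = w - v by ring.
        by apply/rowP => i; rewrite !mxE; ring.
      apply: (le_trans (ler_normD _ _)).
      have := lerD E1 E2; set A := _ + _ + _; set B := _ + _ + _.
      by move=> /le_trans; apply; rewrite /A /B; lra.
  - move=> s /andP[ps sq].
    have [[sp sq' Hs]|/m_bad[e e0 He]] := pselect [/\ s != p, s != q & p < s < q ->
      exists dy r k, [/\ is_derive s (1 : R) y dy, is_derive s (1 : R) psi r, K k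
        & `|dy - k| <= r]].
      have [|dy [r [k [dy1 dpsi Kk dyk]]]] := Hs.
        by rewrite !lt_neqAle ps sq eq_sym sp sq'.
      have e14 : 0 < e1 / 2 by rewrite divr_gt0.
      have [e2 e20 He2] := (is_derive_gaugeP _ _ _).1 dy1 _ e14.
      have [e3 e30 He3] := (is_derive_gaugeP _ _ _).1 dpsi _ e14.
      exists (Num.min e2 e3); first by rewrite lt_min e20.
      move=> u v pu us sv vq; rewrite !lt_min => /andP[su2 su3] /andP[sv2 sv3].
      have us_n : `|u - s| = s - u by rewrite distrC ger0_norm// subr_ge0.
      have vs_n : `|v - s| = v - s by rewrite ger0_norm// subr_ge0.
      have := He2 u; have := He3 u; have := He2 v; have := He3 v.
      rewrite us_n vs_n => /(_ sv3) A1 /(_ sv2) A2 /(_ su3) A3 /(_ su2) A4.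
      exists [::], k; split => //.
      + by rewrite big_nil subr_ge0 m_nd// (le_trans us).
      + rewrite big_nil addr0.
        have -> : y v - y u - (v - u) *: k =
          (y v - y s - (v - s) *: dy) - (y u - y s - (u - s) *: dy) +
          (v - u) *: (dy - k) by apply/rowP => i; rewrite !mxE; ring.
        apply: (le_trans (ler_normD _ _)).
        have B1 := ler_normB (y v - y s - (v - s) *: dy) (y u - y s - (u - s) *: dy).
        have B2 : `|(v - u) *: (dy - k)| <= (v - u) * r.
          have vu0 : 0 <= v - u by lra.
          by rewrite normrZ ger0_norm// ler_wpM2l.
        have B3 : psi v - psi u - (v - u) * r =
            (psi v - psi s - (v - s) *: r) - (psi u - psi s - (u - s) *: r).
          by rewrite /GRing.scale/=; ring.
        have B4 := ler_normB (psi v - psi s - (v - s) *: r) (psi u - psi s - (u - s) *: r).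
        have B5 := ler_norm (- (psi v - psi u - (v - u) * r)).
        rewrite -B3 in B4; rewrite normrN in B5.
        have C : e1 / 2 * (v - s) + e1 / 2 * (s - u) = e1 * (v - u) / 2 by field.
        lra.
    exists e => // u v pu us sv vq su vs.
    exists [:: (u, v)], k0; split => //.
    + by move=> i; rewrite inE => /eqP -> /=; rewrite !lexx (le_trans us).
    + by rewrite big_seq1 /= He.
    + rewrite big_seq1 /=.
      have uv := le_trans us sv.
      have := psi_nd u v pu uv vq.
      have : 0 <= e1 * (v - u) by rewrite mulr_ge0 ?subr_ge0// ltW.
      have := ler_normB (y v - y u) ((v - u) *: k0).
      rewrite normrZ ger0_norm ?subr_ge0// (mulrC (v - u)); lra.
move=> [l [k [Hl pwl Sl Kk E]]]; exists k => //.
apply: le_trans E _.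
have Sdl : \sum_(i <- l) (i.2 - i.1) < dl by apply: le_lt_trans Sl (m_dl _ _).
have Sy : \sum_(i <- l) `|y i.2 - y i.1| < eps / 4.
  by apply: Hac => //; apply: lt_le_trans Sdl _; rewrite ge_min lexx.
rewrite big_split/= -mulr_sumr.
have : `|k0| * \sum_(i <- l) (i.2 - i.1) <= `|k0| * dl.
  by rewrite ler_wpM2l// ltW.
lra.
Qed.

Lemma lipschitz_abs_continuous p q y (k : R) :
  (forall s t, p <= s -> s <= t -> t <= q -> `|y t - y s| <= k * (t - s)) ->
  abs_continuous p q y.
Proof.
move=> ylip e e0; pose k' := Num.max k 1.
have k'0 : 0 < k' by rewrite lt_max ltr01 orbT.
exists (e / k'); first exact: divr_gt0.
move=> m s t Hst _; rewrite ltr_pdivlMr// => /(le_lt_trans _); apply.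
rewrite mulr_suml; apply: ler_sum => i _; have [ps [st tq]] := Hst i.
apply: le_trans (ylip _ _ ps st tq) _.
by rewrite mulrC ler_wpM2l ?subr_ge0// le_max lexx.
Qed.

Lemma abs_continuousB p q y w : abs_continuous p q y -> abs_continuous p q w ->
  abs_continuous p q (fun s => y s - w s).
Proof.
move=> yac wac e e0.
have e20 : 0 < e / 2 by rewrite divr_gt0.
have [d1 d10 H1] := yac _ e20; have [d2 d20 H2] := wac _ e20.
exists (Num.min d1 d2); first by rewrite lt_min d10.
move=> m s t Hst tr; rewrite lt_min => /andP[/(H1 _ _ _ Hst tr) + /(H2 _ _ _ Hst tr)].
move=> A B; rewrite [e]splitr; apply: le_lt_trans (ltrD A B).
rewrite -big_split; apply: ler_sum => i _ /=.
have -> : y (t i) - w (t i) - (y (s i) - w (s i)) =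
  (y (t i) - y (s i)) - (w (t i) - w (s i)) by apply/rowP => j; rewrite !mxE; ring.
exact: ler_normB.
Qed.

Lemma abs_continuousW p q p' q' y : p <= p' -> q' <= q ->
  abs_continuous p q y -> abs_continuous p' q' y.
Proof.
move=> pp qq yac e /yac [dl dl0 H]; exists dl => // m s t Hst; apply: H => i.
have [a [b c]] := Hst i; split; [exact: le_trans a|split => //; exact: le_trans qq].
Qed.

(** Makes the weighted supremum in [gronwall] finite. Below the modulus associated with 1, [y] moves
    by less than 1, and [cousin] glues the local bounds. *)
Lemma abs_continuous_bounded p q y : abs_continuous p q y ->
  exists W : R, forall s, p <= s <= q -> `|y s| <= W.
Proof.
move=> yac; have [pq|qp] := leP p q; last first.
  by exists 0 => s /andP[ps sq]; move: (le_trans ps sq); lra.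
have [dl dl0 H] := abs_continuous_seq yac ltr01.
pose P u v := exists W : R, forall s, u <= s <= v -> `|y s| <= W.
apply: (@cousin _ P p q pq).
- move=> u v w pu uv vw wq [W1 H1] [W2 H2]; exists (Num.max W1 W2) => s /andP[us sw].
  by rewrite le_max; have [sv|vs] := leP s v;
    [rewrite H1 ?us|rewrite H2 ?orbT// (ltW vs)].
- move=> s /andP[ps sq]; exists dl => // u v pu us sv vq su vs.
  exists (`|y s| + 1) => t /andP[ut tv].
  have -> : y t = y s + (y t - y s) by rewrite addrC subrK.
  apply: le_trans (ler_normD _ _) _; rewrite lerD2l ltW//.
  have [st|ts] := leP s t.
    have := H [:: (s, t)]; rewrite !big_seq1 /=; apply => //.
      by move=> i; rewrite inE => /eqP -> /=; rewrite ps st (le_trans tv).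
    lra.
  have := H [:: (t, s)]; rewrite !big_seq1 /= distrC; apply => //.
    by move=> i; rewrite inE => /eqP -> /=; rewrite sq (le_trans pu ut) (ltW ts).
  lra.
Qed.

(** The mean value inequality: with [K] reduced to 0 the whole derivative counts as error. A general
    [psi] is kept because Gronwall and Picard use an exponential one. *)
Lemma norm_increment_le p q y (psi : R -> R) :
  p <= q -> abs_continuous p q y ->
  (forall u v, p <= u -> u <= v -> v <= q -> psi u <= psi v) ->
  {ae mu, forall s, p < s < q -> exists dy r,
     [/\ is_derive s (1 : R) y dy, is_derive s (1 : R) psi r & `|dy| <= r]} ->
  `|y q - y p| <= psi q - psi p.
Proof.
move=> pq yac psi_nd yd; apply/ler_addgt0Pr => e e0.
have [||||k ->] := @increment_in_convex p q y psi [set 0] e pq yac psi_nd.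
- by move=> a b t /= -> -> _; rewrite !scaler0 addr0.
- by exists 0.
- apply: ae_imply yd => s + spq => /(_ spq)[dy [r [? ? ?]]].
  by exists dy, r, 0; rewrite subr0.
- exact: e0.
- by rewrite scaler0 subr0.
Qed.

End increments.

(** * Gronwall's lemma, primitives, differential equations *)

Section gronwall.
Context {R : realType} {d : nat}.
Local Notation mu := (@lebesgue_measure R).
Local Notation V := 'rV[R]_d.
Implicit Types (y w : R -> V) (p q s t : R).

Lemma is_derive_exp_affine (a b c L p s : R) :
  is_derive s (1 : R) (fun t => a + c * t + b * expR (L * (t - p)))
    (c + b * (L * expR (L * (s - p)))).
Proof.
have H : is_derive s (1 : R) (fun t => L * (t - p)) L.
  apply: is_derive_eq; rewrite ?scaler0 ?addr0 ?oppr0 ?addr0.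
  by rewrite /GRing.scale/= mulr1.
have He : is_derive s (1 : R) (fun t => expR (L * (t - p)))
    (expR (L * (s - p)) * L).
  exact: (@is_derive1_comp _ expR (fun t => L * (t - p))).
apply: is_derive_eq.
rewrite /GRing.scale/= ?mulr0 ?add0r ?addr0 ?mulr1.
ring.
Qed.

Lemma exp_affine_nd (a b c L p u v : R) : 0 <= c -> 0 <= b -> 0 <= L -> u <= v ->
  a + c * u + b * expR (L * (u - p)) <= a + c * v + b * expR (L * (v - p)).
Proof.
move=> c0 b0 L0 uv; rewrite lerD ?lerD2l ?ler_wpM2l// ler_expR.
by rewrite ler_wpM2l ?lerB.
Qed.

(* The weight exp(2 L s) halves the supremum under integration, so the
   supremum of the weighted norm absorbs its own contribution. *)
Lemma gronwall p q w (c L : R) : p <= q -> 0 <= c -> 0 < L ->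
  abs_continuous p q w ->
  {ae mu, forall s, p < s < q ->
     exists2 dw, is_derive s (1 : R) w dw & `|dw| <= c + L * `|w s|} ->
  forall s, p <= s <= q ->
    `|w s| <= 2 * (`|w p| + c * (q - p)) * expR (2 * L * (s - p)).
Proof.
move=> pq c0 L0 wac wd.
have [W HW] := abs_continuous_bounded wac.
pose E s := expR (2 * L * (s - p)).
have E0 s : 0 < E s by exact: expR_gt0.
have E1 s : p <= s -> 1 <= E s.
  by move=> ps; rewrite -expR0 ler_expR !mulr_ge0 ?subr_ge0// ltW.
pose A := [set `|w s| / E s | s in `[p, q]%classic].
have Aub : has_ubound A.
  exists W => z [s /=]; rewrite in_itv/= => /andP[ps sq] <-.
  rewrite ler_pdivrMr//; apply: (le_trans (HW s _)); first by rewrite ps sq.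
  rewrite ler_peMr ?E1//; apply: (le_trans _ (HW s _)) => //.
  by rewrite ps sq.
have Ap : A (`|w p| / E p) by exists p => //=; rewrite in_itv/= lexx pq.
have hA : has_sup A by split; [exists (`|w p| / E p)|].
pose S := sup A.
have wS s : p <= s <= q -> `|w s| <= S * E s.
  move=> spq; rewrite -ler_pdivrMr//; apply: ub_le_sup => //.
  by exists s => //=; rewrite in_itv.
have S0 : 0 <= S.
  have := wS p; rewrite lexx pq => /(_ isT) /(le_trans (normr_ge0 _)).
  by rewrite pmulr_lge0.
pose B := `|w p| + c * (q - p).
have main s : p <= s <= q -> `|w s| <= B + S / 2 * E s.
  move=> /andP[ps sq].
  (* The derivative of [psi] is [c + L * (S * E t)], which dominates that of [w]. The factor 2 in
     the exponent of [E] is what produces [S / 2], hence [S <= 2 * B] below. *)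
  pose psi t := 0 + c * t + S / 2 * expR (2 * L * (t - p)).
  have : `|w s - w p| <= psi s - psi p.
    apply: norm_increment_le => //.
    - exact: abs_continuousW wac.
    - by move=> u v _ uv _; apply: exp_affine_nd => //; rewrite ?divr_ge0// mulr_ge0// ltW.
    - apply: ae_imply wd => t H /andP[pt ts].
      have [|dw dw1 dw2] := H; first by rewrite pt (lt_le_trans ts).
      exists dw, (c + S / 2 * (2 * L * expR (2 * L * (t - p)))); split => //.
        exact: is_derive_exp_affine.
      apply: (le_trans dw2); rewrite lerD2l.
      have -> : S / 2 * (2 * L * expR (2 * L * (t - p))) = L * (S * E t).
        by rewrite /E; field.
      by rewrite ler_pM2l// wS// (ltW pt) (le_trans (ltW ts)).
  rewrite /psi subrr mulr0 expR0 mulr1 -/(E s) => H.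
  have H1 : `|w s| <= `|w p| + `|w s - w p|.
    by apply: le_trans (ler_normD _ _); rewrite addrC subrK.
  have : c * (s - p) <= c * (q - p) by rewrite ler_wpM2l// lerB.
  rewrite /B; lra.
have B0 : 0 <= B by rewrite addr_ge0// mulr_ge0// subr_ge0.
have : S <= B + S / 2.
  apply: ge_sup hA.1 _ => z [s /=]; rewrite in_itv/= => spq <-.
  rewrite ler_pdivrMr//; apply: (le_trans (main s spq)).
  rewrite mulrDl lerD2r ler_peMr// E1//.
  by case/andP: spq.
move=> SB s spq; apply: (le_trans (wS s spq)).
rewrite ler_pM2r ?expR_gt0// -/B; lra.
Qed.

Lemma ode_unique (h : R -> V -> V) p q y w (L : R) : p <= q -> 0 < L ->
  (forall s x x', p < s < q -> `|h s x - h s x'| <= L * `|x - x'|) ->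
  abs_continuous p q y -> abs_continuous p q w -> y p = w p ->
  {ae mu, forall s, p < s < q -> is_derive s (1 : R) y (h s (y s))} ->
  {ae mu, forall s, p < s < q -> is_derive s (1 : R) w (h s (w s))} ->
  forall s, p <= s <= q -> y s = w s.
Proof.
move=> pq L0 hL yac wac ywp yd wd s spq.
have := @gronwall p q (fun s => y s - w s) 0 L pq (lexx 0) L0 (abs_continuousB yac wac).
rewrite ywp subrr normr0 mul0r addr0 mulr0.
move=> /(_ _ s spq); rewrite mul0r normr_le0 subr_eq0 => H.
apply/eqP/H; apply: ae_imply (ae_conj yd wd) => {H spq}s [ys ws] spq.
have dy := ys spq; have dw := ws spq.
exists (h s (y s) - h s (w s)); last by rewrite add0r hL.
exact: is_deriveB.
Qed.

End gronwall.

Lemma small_geometric {R : realType} (C e : R) : 0 < e -> exists n, C / 2 ^+ n < e.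
Proof.
move=> e0; have : (fun n => C / 2 ^+ n : R) @ \oo --> (0 : R).
  rewrite -[X in _ --> X](mulr0 C).
  apply: cvgM; first exact: cvg_cst.
  rewrite (_ : (fun n => _) = (fun n => (2^-1 : R) ^+ n)); last first.
    by apply/funext => n; rewrite exprVn.
  by apply: cvg_expr; rewrite gtr0_norm ?invr_gt0// invf_lt1// ltr1n.
move=> /cvgrPdist_lt/(_ e e0) [n _ /(_ n (leqnn n))] /=.
by rewrite sub0r normrN => /(le_lt_trans (ler_norm _)); exists n.
Qed.

Lemma geometric_limit {R : realType} {d : nat} (u : nat -> 'rV[R]_d) (C : R) :
  (forall n, `|u n.+1 - u n| <= C / 2 ^+ n) ->
  exists l, forall n, `|l - u n| <= 2 * C / 2 ^+ n.
Proof.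
move=> uC.
have C0 : 0 <= C by have := uC 0%N; rewrite expr0 divr1; apply: le_trans.
have um n k : `|u (n + k)%N - u n| <= 2 * C / 2 ^+ n - 2 * C / 2 ^+ (n + k).
  elim: k => [|k IH]; first by rewrite addn0 !subrr normr0.
  have -> : u (n + k.+1)%N - u n = (u (n + k).+1 - u (n + k)%N) + (u (n + k)%N - u n).
    by rewrite addnS addrA subrK.
  apply: le_trans (ler_normD _ _) _; apply: le_trans (lerD (uC _) IH) _.
  rewrite addnS exprS.
  have e0 : (2 : R) ^+ (n + k) != 0 by rewrite expf_neq0.
  rewrite [leLHS](_ : _ = 2 * C / 2 ^+ n - 2 * C / (2 * 2 ^+ (n + k)))//.
  have e1 : (2 : R) ^+ n != 0 by rewrite expf_neq0.
  by field; rewrite e0 e1.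
have um' n k : `|u (n + k)%N - u n| <= 2 * C / 2 ^+ n.
  apply: le_trans (um n k) _.
  by rewrite gerBl divr_ge0 ?mulr_ge0 ?exprn_ge0.
have ucauchy : cauchy (u @ \oo).
  apply: cauchy_exP => e e0; have [n ne] := small_geometric (2 * C) e0.
  exists (u n); exists n => // m /= nm; rewrite -ball_normE/= distrC.
  by apply: le_lt_trans ne; rewrite -(subnKC nm).
have cvu : cvg (u @ \oo) by exact: cauchy_cvg.
exists (lim (u @ \oo)) => n.
have cvn : `|u m - u n| @[m --> \oo] --> `|lim (u @ \oo) - u n|.
  by apply: cvg_norm; apply: cvgB => //; exact: cvg_cst.
rewrite -(cvg_lim _ cvn)//.
apply: limr_le; first by apply/cvg_ex; eexists; exact: cvn.
by exists n => // m /= nm; rewrite -(subnKC nm).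
Qed.

Section primitives.
Context {R : realType} {d : nat}.
Local Notation mu := (@lebesgue_measure R).
Local Notation V := 'rV[R]_d.
Implicit Types (y w : R -> V) (p q s t : R).

Definition lipschitz_itv p q y :=
  exists k : R, forall s t, p <= s -> s <= t -> t <= q -> `|y t - y s| <= k * (t - s).

(** Lipschitz continuity is part of the notion because an a.e. derivative alone does not determine
    increments (think of the Cantor function). *)
Definition has_primitive p q (h : R -> V) :=
  exists2 H : R -> V, lipschitz_itv p q H &
    {ae mu, forall s, p < s < q -> is_derive s (1 : R) H (h s)}.

Lemma increment_le_of_deriv p q y (c : R) : 0 <= c -> abs_continuous p q y ->
  {ae mu, forall s, p < s < q -> exists2 dy, is_derive s (1 : R) y dy & `|dy| <= c} ->
  forall s t, p <= s -> s <= t -> t <= q -> `|y t - y s| <= c * (t - s).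
Proof.
move=> c0 yac yd s t ps st tq.
have := @norm_increment_le _ _ s t y (fun r => c * r) st (abs_continuousW ps tq yac).
rewrite mulrBr; apply => [u v _ uv _|]; first by rewrite ler_wpM2l.
apply: ae_imply yd => r H /andP[sr rt].
have [|dy dy1 dyc] := H; first by rewrite (le_lt_trans ps sr) (lt_le_trans rt tq).
exists dy, c; split => //.
by apply: is_derive_eq; rewrite /GRing.scale/= mulr1.
Qed.

(* Increments of the primitives converge at the uniform rate of the
   integrands, so difference quotients pass to the limit at every common
   point of differentiability. *)
Lemma has_primitive_limit p q (h : R -> V) : p <= q ->
  (forall e : R, 0 < e -> exists2 h', has_primitive p q h' &
     forall s, p < s < q -> `|h s - h' s| <= e) ->
  has_primitive p q h.
Proof.
move=> pq happ.
have e0 n : 0 < (2 ^+ n : R)^-1 by rewrite invr_gt0 exprn_gt0.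
have /choice[hn Hhn] : forall n, exists hH : (R -> V) * (R -> V),
    [/\ lipschitz_itv p q hH.2,
     {ae mu, forall s, p < s < q -> is_derive s (1 : R) hH.2 (hH.1 s)} &
     forall s, p < s < q -> `|h s - hH.1 s| <= (2 ^+ n)^-1].
  move=> n; have [h' [H lH dH] h'n] := happ _ (e0 n).
  by exists (h', H); split.
pose H n := (hn n).2.
have Hac n : abs_continuous p q (H n).
  by have [[k Hk] _ _] := Hhn n; exact: lipschitz_abs_continuous Hk.
have Hdiff n m s t : p <= s -> s <= t -> t <= q ->
    `|H n t - H n s - (H m t - H m s)| <= ((2 ^+ n)^-1 + (2 ^+ m)^-1) * (t - s).
  move=> ps st tq.
  have -> : H n t - H n s - (H m t - H m s) = (H n t - H m t) - (H n s - H m s).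
    by apply/rowP => i; rewrite !mxE; ring.
  apply: (@increment_le_of_deriv p q (fun s => H n s - H m s)) => //.
  - exact: abs_continuousB.
  - have [_ dn hnn] := Hhn n; have [_ dm hmm] := Hhn m.
    apply: ae_imply (ae_conj dn dm) => r [rn rm] rpq.
    have dn' := rn rpq; have dm' := rm rpq.
    exists ((hn n).1 r - (hn m).1 r); first exact: is_deriveB.
    have -> : (hn n).1 r - (hn m).1 r = (h r - (hn m).1 r) - (h r - (hn n).1 r).
      by apply/rowP => i; rewrite !mxE; ring.
    by apply: le_trans (ler_normB _ _) _; rewrite addrC lerD ?hnn ?hmm.
have pow n : (2 ^+ n.+1 : R)^-1 = (2 ^+ n)^-1 / 2 by rewrite exprS invfM mulrC.
pose C := 2 * (q - p).
have C0 : 0 <= C by rewrite mulr_ge0 ?subr_ge0.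
(* Primitives are determined up to constants, so only [H n s - H n p] can converge. *)
have /choice[G HG] : forall s, exists l : V, p <= s <= q ->
    forall n, `|l - (H n s - H n p)| <= 2 * C / 2 ^+ n.
  move=> s; have [/andP[ps sq]|] := boolP (p <= s <= q); last by exists 0.
  have [n|l Hl] := @geometric_limit R d (fun n => H n s - H n p) C; last by exists l.
  apply: le_trans (Hdiff _ _ _ _ (lexx p) ps sq) _.
  rewrite pow /C.
  have : (2 ^+ n)^-1 * (s - p) <= (2 ^+ n)^-1 * (q - p) by rewrite ler_pM2l// lerB.
  have : 0 <= (2 ^+ n)^-1 * (s - p) by rewrite mulr_ge0 ?subr_ge0// ltW.
  lra.
have Gdiff n s t : p <= s -> s <= t -> t <= q ->
    `|G t - G s - (H n t - H n s)| <= 2 * (2 ^+ n)^-1 * (t - s).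
  move=> ps st tq; apply/ler_addgt0Pr => e ee0.
  have spq : p <= s <= q by rewrite ps (le_trans st).
  have tpq : p <= t <= q by rewrite (le_trans ps st).
  have ee02 : 0 < e / 2 by rewrite divr_gt0.
  have [m0 Hm0] := small_geometric (2 * C) ee02.
  pose m := maxn m0 n.
  have Hm : 2 * C / 2 ^+ m <= e / 2.
    apply: le_trans (ltW Hm0); apply: ler_wpM2l; first by rewrite mulr_ge0.
    by rewrite lef_pV2 ?posrE ?exprn_gt0// ler_eXn2l ?ltr1n// leq_maxl.
  have Hmn : (2 ^+ m : R)^-1 <= (2 ^+ n)^-1.
    by rewrite lef_pV2 ?posrE ?exprn_gt0// ler_eXn2l ?ltr1n// leq_maxr.
  have A := Hdiff m n s t ps st tq.
  have B := HG t tpq m; have D := HG s spq m.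
  have -> : G t - G s - (H n t - H n s) =
    ((G t - (H m t - H m p)) - (G s - (H m s - H m p))) +
    (H m t - H m s - (H n t - H n s)) by apply/rowP => i; rewrite !mxE; ring.
  apply: le_trans (ler_normD _ _) _.
  have := ler_normB (G t - (H m t - H m p)) (G s - (H m s - H m p)).
  have : (2 ^+ m)^-1 * (t - s) <= (2 ^+ n)^-1 * (t - s).
    by rewrite ler_wpM2r ?subr_ge0.
  lra.
exists G.
  have [[k Hk] _ _] := Hhn 0%N; exists (k + 2) => s t ps st tq.
  have -> : G t - G s = (H 0%N t - H 0%N s) + (G t - G s - (H 0%N t - H 0%N s)).
    by rewrite [RHS]addrC subrK.
  apply: le_trans (ler_normD _ _) _; rewrite mulrDl lerD ?Hk//.
  by have := Gdiff 0%N s t ps st tq; rewrite expr0 invr1 mulr1.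
have dall : {ae mu, forall s, forall n, p < s < q ->
    is_derive s (1 : R) (H n) ((hn n).1 s)}.
  by apply/ae_foralln => n; have [] := Hhn n.
apply: ae_imply dall => s Hs spq; apply/is_derive_gaugeP => eps eps0.
have eps2 : 0 < eps / 2 by rewrite divr_gt0.
(* The [3] adds the [2] of [Gdiff] to the [1] of the distance between the integrands. *)
have [n Hn] := small_geometric 3 eps2.
have [e ee0 He] := (is_derive_gaugeP _ _ _).1 (Hs n spq) _ eps2.
have [ps sq] := andP spq.
exists (Num.min e (Num.min (s - p) (q - s))).
  by rewrite !lt_min ee0 !subr_gt0 ps sq.
move=> t; rewrite !lt_min => /and3P[te tp tq].
have pt : p <= t by move: tp; rewrite ltr_norml; lra.
have tq' : t <= q by move: tq; rewrite ltr_norml; lra.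
have A : `|G t - G s - (H n t - H n s)| <= 2 * (2 ^+ n)^-1 * `|t - s|.
  have [st|ts] := leP s t.
    by rewrite (ger0_norm (_ : 0 <= t - s)) ?subr_ge0// Gdiff// ltW.
  rewrite (distrC t s) (ger0_norm (_ : 0 <= s - t)) ?subr_ge0 ?(ltW ts)//.
  have -> : G t - G s - (H n t - H n s) = - (G s - G t - (H n s - H n t)).
    by apply/rowP => i; rewrite !mxE; ring.
  by rewrite normrN Gdiff// ltW.
have B := He t te.
have D : `|(t - s) *: ((hn n).1 s - h s)| <= (2 ^+ n)^-1 * `|t - s|.
  rewrite normrZ mulrC ler_wpM2r// distrC.
  by have [_ _] := Hhn n; exact.
have -> : G t - G s - (t - s) *: h s = (G t - G s - (H n t - H n s)) +
    (H n t - H n s - (t - s) *: (hn n).1 s) + (t - s) *: ((hn n).1 s - h s).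
  by apply/rowP => i; rewrite !mxE; ring.
apply: le_trans (ler_normD _ _) _.
have E := ler_normD (G t - G s - (H n t - H n s)) (H n t - H n s - (t - s) *: (hn n).1 s).
have F : 3 / 2 ^+ n * `|t - s| <= eps / 2 * `|t - s| by rewrite ler_wpM2r// ltW.
lra.
Qed.

End primitives.

Section picard.
Context {R : realType} {d : nat}.
Local Notation mu := (@lebesgue_measure R).
Local Notation V := 'rV[R]_d.
Implicit Types (y w : R -> V) (p q s t : R).

(** In the norm weighted by [E] the Picard map contracts by 1/2 on all of [[p, q]], so no
    subdivision into short intervals is needed. Primitives are only requested along Lipschitz
    curves, because every iterate is one. *)
Lemma picard (h : R -> V -> V) p q (x : V) (L : R) : p <= q -> 0 < L ->
  (forall s x x', p < s < q -> `|h s x - h s x'| <= L * `|x - x'|) ->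
  (forall y, lipschitz_itv p q y -> has_primitive p q (fun s => h s (y s))) ->
  exists y, [/\ y p = x, abs_continuous p q y &
    {ae mu, forall s, p < s < q -> is_derive s (1 : R) y (h s (y s))}].
Proof.
move=> pq L0 hL hprim.
have /choice[Phi HPhi] : forall y, exists Py : R -> V, lipschitz_itv p q y ->
    [/\ lipschitz_itv p q Py, Py p = x &
      {ae mu, forall s, p < s < q -> is_derive s (1 : R) Py (h s (y s))}].
  move=> y; have [/hprim[H lH dH]|ny] := pselect (lipschitz_itv p q y); last by exists y.
  exists (fun s => H s + (x - H p)) => _; split.
  - have [k Hk] := lH; exists k => s t ps st tq.
    have -> : H t + (x - H p) - (H s + (x - H p)) = H t - H s.
      by apply/rowP => i; rewrite !mxE; ring.
    exact: Hk.
  - by rewrite addrC subrK.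
  - apply: ae_imply dH => s Hs /Hs dHs.
    have := is_deriveD dHs (is_derive_cst (x - H p) s 1).
    by rewrite addr0.
pose E s := expR (2 * L * (s - p)).
have E0 s : 0 < E s by exact: expR_gt0.
have E1 s : p <= s -> 1 <= E s.
  by move=> ps; rewrite -expR0 ler_expR !mulr_ge0 ?subr_ge0// ltW.
(* No regularity is asked of [y] and [w], so that this also applies to the limit [G] of the
   iterates. *)
have contr y w K : 0 <= K ->
    (forall s, p <= s <= q -> `|y s - w s| <= K * E s) ->
    forall (Py Pw : R -> V), lipschitz_itv p q Py -> lipschitz_itv p q Pw -> Py p = Pw p ->
    {ae mu, forall s, p < s < q -> is_derive s (1 : R) Py (h s (y s))} ->
    {ae mu, forall s, p < s < q -> is_derive s (1 : R) Pw (h s (w s))} ->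
    forall s, p <= s <= q -> `|Py s - Pw s| <= K / 2 * E s.
  move=> K0 yw Py Pw [k1 lPy] [k2 lPw] Pp dy dw s /andP[ps sq].
  pose psi t := 0 + 0 * t + K / 2 * expR (2 * L * (t - p)).
  have : `|(Py s - Pw s) - (Py p - Pw p)| <= psi s - psi p.
    apply: (@norm_increment_le _ _ p s (fun s => Py s - Pw s)) => //.
    - apply: (@abs_continuousW _ _ p q) => //; apply: abs_continuousB.
        exact: lipschitz_abs_continuous lPy.
      exact: lipschitz_abs_continuous lPw.
    - by move=> u v _ uv _; apply: exp_affine_nd => //; rewrite ?divr_ge0// mulr_ge0// ltW.
    - apply: ae_imply (ae_conj dy dw) => t [ty tw] /andP[pt ts].
      have tpq : p < t < q by rewrite pt (lt_le_trans ts).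
      have dy' := ty tpq; have dw' := tw tpq.
      exists (h t (y t) - h t (w t)), (0 + K / 2 * (2 * L * expR (2 * L * (t - p)))).
      split; [exact: is_deriveB|exact: is_derive_exp_affine|].
      apply: le_trans (hL _ _ _ tpq) _; rewrite add0r.
      have -> : K / 2 * (2 * L * expR (2 * L * (t - p))) = L * (K * E t).
        by rewrite /E; field.
      by rewrite ler_pM2l// yw// !ltW//; case/andP: tpq.
  rewrite Pp subrr subr0 /psi !mul0r !add0r => /le_trans; apply.
  by rewrite gerBl mulr_ge0 ?divr_ge0// ltW// expR_gt0.
pose Y := fix Y n := if n is n'.+1 then Phi (Y n') else cst x.
have lY n : lipschitz_itv p q (Y n).
  elim: n => [|n IH]; first by exists 0 => s t *; rewrite subrr normr0 mul0r.
  by have [] := HPhi _ IH.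
have Yp n : Y n p = x by case: n => [//|n]; have [] := HPhi _ (lY n).
have dY n : {ae mu, forall s, p < s < q -> is_derive s (1 : R) (Y n.+1) (h s (Y n s))}.
  by have [] := HPhi _ (lY n).
have [K0 K00 HK0] : exists2 K, 0 <= K &
    forall s, p <= s <= q -> `|Y 1%N s - Y 0%N s| <= K * E s.
  have [k Hk] := lY 1%N; exists (`|k| * (q - p)); first by rewrite mulr_ge0// subr_ge0.
  move=> s /andP[ps sq]; have := Hk p s (lexx p) ps sq; rewrite Yp => H.
  apply: (le_trans H); apply: (@le_trans _ _ (`|k| * (q - p))).
    apply: (@le_trans _ _ (`|k| * (s - p))).
      by rewrite ler_wpM2r ?subr_ge0// ler_norm.
    by rewrite ler_wpM2l// lerB.
  by rewrite ler_peMr ?E1// mulr_ge0// subr_ge0.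
have Ydiff n s : p <= s <= q -> `|Y n.+1 s - Y n s| <= K0 / 2 ^+ n * E s.
  elim: n s => [|n IH] s spq; first by rewrite expr0 divr1 HK0.
  have -> : K0 / 2 ^+ n.+1 = K0 / 2 ^+ n / 2 by rewrite exprS invfM; ring.
  apply: (contr _ _ _ _ IH) => //; first by rewrite divr_ge0// exprn_ge0.
  by rewrite !Yp.
have /choice[G HG] : forall s, exists l : V, p <= s <= q ->
    forall n, `|l - Y n s| <= 2 * (K0 / 2 ^+ n) * E s.
  move=> s; have [spq|] := boolP (p <= s <= q); last by exists 0.
  have [n|l Hl] := @geometric_limit R d (fun n => Y n s) (K0 * E s).
    by apply: le_trans (Ydiff n s spq) _; rewrite mulrAC.
  exists l => _ n; apply: le_trans (Hl n) _.
  by rewrite le_eqVlt; apply/orP; left; apply/eqP; ring.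
have Eq s : s <= q -> E s <= E q.
  by move=> sq; rewrite ler_expR ler_wpM2l ?lerB// mulr_ge0// ltW.
(* [G] is not yet known to be Lipschitz, so [hprim] does not apply to it; the primitive comes from
   the uniform limit of the integrands along the iterates. *)
have [H [k lH] dH] : has_primitive p q (fun s => h s (G s)).
  apply: has_primitive_limit => // e e0.
  have [n Hn] := small_geometric (L * 2 * K0 * E q) e0.
  exists (fun s => h s (Y n s)); first exact: hprim.
  move=> s spq; have spq' : p <= s <= q by case/andP: spq => ? ?; rewrite !ltW.
  apply: le_trans (hL _ _ _ spq) _.
  apply: le_trans (ltW Hn).
  have -> : L * 2 * K0 * E q / 2 ^+ n = L * (2 * (K0 / 2 ^+ n) * E q) by ring.
  rewrite ler_pM2l//; apply: le_trans (HG s spq' n) _.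
  rewrite ler_wpM2l ?Eq//; first by rewrite mulr_ge0// divr_ge0// exprn_ge0.
  by case/andP: spq'.
have lG n s : p <= s <= q -> `|G s - Y n s| <= 2 * (K0 / 2 ^+ n) * E s by move=> /HG.
pose Z s := H s + (x - H p).
have lZ : lipschitz_itv p q Z.
  exists k => s t ps st tq; rewrite /Z.
  have -> : H t + (x - H p) - (H s + (x - H p)) = H t - H s.
    by apply/rowP => i; rewrite !mxE; ring.
  exact: lH.
have Zp : Z p = x by rewrite /Z addrC subrK.
have dZ : {ae mu, forall s, p < s < q -> is_derive s (1 : R) Z (h s (G s))}.
  apply: ae_imply dH => s Hs /Hs dHs.
  by have := is_deriveD dHs (is_derive_cst (x - H p) s 1); rewrite addr0.
have ZG s : p <= s <= q -> Z s = G s.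
  move=> spq; apply/eqP; rewrite -subr_eq0 -normr_le0; apply/ler_addgt0Pr => e e0.
  have [n Hn] := small_geometric (2 * K0 * E s) e0.
  rewrite add0r; apply: le_trans (ltW Hn).
  have Kn0 : 0 <= 2 * (K0 / 2 ^+ n) by rewrite mulr_ge0// divr_ge0// exprn_ge0.
  have A := contr G (Y n) _ Kn0 (lG n) Z (Y n.+1) lZ (lY n.+1) _ dZ (dY n) s spq.
  have B := lG n.+1 s spq.
  have -> : Z s - G s = (Z s - Y n.+1 s) - (G s - Y n.+1 s).
    by apply/rowP => i; rewrite !mxE; ring.
  apply: le_trans (ler_normB _ _) _; apply: le_trans (lerD (A _) B) _.
    by rewrite Zp Yp.
  have -> : K0 / 2 ^+ n.+1 = K0 / 2 ^+ n / 2 by rewrite exprS invfM; ring.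
  rewrite le_eqVlt; apply/orP; left; apply/eqP; field.
  by rewrite expf_neq0.
exists Z; split => //.
  by have [k' lZ'] := lZ; exact: lipschitz_abs_continuous lZ'.
apply: ae_imply dZ => s Hs spq; rewrite ZG; first exact: Hs.
by case/andP: spq => ? ?; rewrite !ltW.
Qed.

End picard.

(** * Dynamics driven by Lebesgue measurable controls *)

Section measurable_controls.
Context {R : realType}.
Local Notation mu := (@lebesgue_measure R).

Lemma measurable_lebesgueR (E : set R) : measurable E ->
  measurable (E : set (lebesgueR R)).
Proof.
by move=> mE; apply: sub_sigma_algebra; exists E => //; exists set0;
  [exact: negligible_set0|rewrite setU0].
Qed.

(** Reduces Lebesgue measurable sets to Borel ones, for which Lebesgue differentiation is
    available. *)
Lemma lebesgueR_split (E : set R) : measurable (E : set (lebesgueR R)) ->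
  exists2 A : set R, measurable A & {ae mu, forall s, E s <-> A s}.
Proof.
move=> mE; have [A mA [N [M [mM M0 NM]] <-]] : completed_algebra_gen mu E.
  by rewrite -g_sigma_completed_algebra_genE.
exists A => //; exists M; split => // s /= H; apply: NM.
by apply: contrapT => nNs; apply: H; split => [[//|/nNs//]|As]; left.
Qed.

(** The Lebesgue density theorem, obtained from the first fundamental theorem of calculus for a
    locally integrable indicator. *)
Lemma ae_deriv_measure_itv (A : set R) (p : R) : measurable A ->
  {ae mu, forall s, p < s ->
    is_derive s (1 : R) (fun t => fine (mu (A `&` `[p, t]))) (\1_A s)}.
Proof.
move=> mA.
have iA y : mu.-integrable `[p, y] (EFin \o \1_A).
  have [_ _ HK] := locally_integrable_indic openT mA.
  apply/integrableP; split.
    by apply/measurable_EFinP; apply: measurable_funTS; exact: measurable_indic.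
  have := HK `[p, y]%classic (@subsetT _ _) (@segment_compact _ p y).
  by under eq_integral do rewrite /= -abse_EFin.
have := FTC1 iA (locally_integrable_indic openT mA).
apply: ae_imply => s H ps.

have [|dF F1] := H; first by rewrite (@lte_fin R).
set F := (fun x => _) in dF F1.
have dF' : is_derive s (1 : R) F (\1_A s) by split => //; rewrite -derive1E.
rewrite (_ : F = (fun t : R => fine (mu (A `&` `[p, t])))) in dF'; first exact: dF'.
by apply/funext => x; rewrite /F /Rintegral integral_indic.
Qed.

Lemma measure_itv_lipschitz (A : set R) (p s t : R) : measurable A -> s <= t ->
  p <= s ->
  `|fine (mu (A `&` `[p, t])) - fine (mu (A `&` `[p, s]))| <= t - s.
Proof.
move=> mA st ps.
have fin u v : mu (A `&` `]u, v]) \is a fin_num.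
  rewrite ge0_fin_numE// (@le_lt_trans _ _ (mu `]u, v]%classic))//.
    by apply: le_measure; rewrite ?inE//; exact: measurableI.
  by rewrite lebesgue_measure_itv/=; case: ifPn => // _; rewrite -EFinB ltry.
have fin' u : mu (A `&` `[p, u]) \is a fin_num.
  rewrite ge0_fin_numE// (@le_lt_trans _ _ (mu `[p, u]%classic))//.
    by apply: le_measure; rewrite ?inE//; exact: measurableI.
  by rewrite lebesgue_measure_itv/=; case: ifPn => // _; rewrite -EFinB ltry.
have E : A `&` `[p, t] = (A `&` `[p, s]) `|` (A `&` `]s, t]).
  rewrite -setIUr; congr (_ `&` _).
  apply/seteqP; split => x /=; rewrite !in_itv/=.
    by move=> /andP[-> xt]; have [xs|sx] := leP x s; [left|right].
  move=> [/andP[-> xs]|/andP[sx ->]]; first exact: le_trans xs st.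
  by rewrite andbT (le_trans ps (ltW sx)).
have -> : mu (A `&` `[p, t]) = (mu (A `&` `[p, s]) + mu (A `&` `]s, t]))%E.
  rewrite E measureU//; [exact: measurableI|exact: measurableI|].
  by rewrite -subset0 => x [[_ /=]] + [_ /=]; rewrite !in_itv/=; lra.
rewrite fineD// addrAC subrr add0r ger0_norm ?fine_ge0//.
rewrite -lee_fin fineK// (@le_trans _ _ (mu `]s, t]%classic))//.
  by apply: le_measure; rewrite ?inE//; exact: measurableI.
rewrite lebesgue_measure_itv/= lte_fin; case: ifPn => // _.
by rewrite lee_fin subr_ge0.
Qed.

Context {d : nat}.
Local Notation V := 'rV[R]_d.

Lemma has_primitive_indic (p q : R) (E : set R) (v : V) : p <= q ->
  measurable (E : set (lebesgueR R)) -> has_primitive p q (fun s => \1_E s *: v).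
Proof.
move=> pq /lebesgueR_split[A mA EA].
exists (fun t => fine (mu (A `&` `[p, t])) *: v).
  exists `|v| => s t ps st tq; rewrite -scalerBl normrZ mulrC ler_wpM2l//.
  exact: measure_itv_lipschitz.
apply: ae_imply (ae_conj EA (ae_deriv_measure_itv p mA)) => s [EAs H] /andP[/H{}H _].
have -> : \1_E s = \1_A s :> R by rewrite !indicE; congr (_%:R); congr nat_of_bool;
  apply/idP/idP; rewrite !inE => /EAs.
apply/is_derive_gaugeP => eps eps0.
have v0 : 0 < `|v| + 1 by rewrite ltr_wpDl.
have ev0 : 0 < eps / (`|v| + 1) by rewrite divr_gt0.
have [e e0 He] := (is_derive_gaugeP _ _ _).1 H _ ev0.
exists e => // t /He {}He.
rewrite -scalerBl scalerA -scalerBl normrZ.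
apply: (@le_trans _ _ (eps / (`|v| + 1) * `|t - s| * `|v|)); first by rewrite ler_wpM2r.
rewrite mulrAC ler_wpM2r// mulrAC ler_pdivrMr// ler_pM2l//.
by rewrite lerDl.
Qed.

Lemma has_primitiveD (p q : R) (g h : R -> V) : has_primitive p q g ->
  has_primitive p q h -> has_primitive p q (fun s => g s + h s).
Proof.
move=> [G [k Gk] dG] [H [l Hl] dH]; exists (fun s => G s + H s).
  exists (k + l) => s t ps st tq.
  have -> : G t + H t - (G s + H s) = (G t - G s) + (H t - H s).
    by apply/rowP => i; rewrite !mxE; ring.
  by rewrite (le_trans (ler_normD _ _))// mulrDl lerD ?Gk ?Hl.
apply: ae_imply (ae_conj dG dH) => s [+ +] spq => /(_ spq) A /(_ spq) B.
exact: is_deriveD.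
Qed.

Lemma eq_has_primitive (p q : R) (g h : R -> V) :
  (forall s, p < s < q -> g s = h s) -> has_primitive p q g -> has_primitive p q h.
Proof.
move=> gh [G lG dG]; exists G => //; apply: ae_imply dG => s Hs spq.
by rewrite -gh//; exact: Hs.
Qed.

Lemma has_primitive_fin (p q : R) (I : finType) (i_ : R -> I) (v : I -> V) : p <= q ->
  (forall i, measurable (`]p, q[%classic `&` i_ @^-1` [set i] : set (lebesgueR R))) ->
  has_primitive p q (fun s => v (i_ s)).
Proof.
move=> pq mi.
apply: (@eq_has_primitive _ _
    (fun s => \sum_i \1_(`]p, q[%classic `&` i_ @^-1` [set i]) s *: v i)).
  move=> s spq; rewrite (bigD1 (i_ s))//= big1 ?addr0.
    by rewrite indicE mem_set ?scale1r//=; split => //; rewrite in_itv.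
  by move=> i ii; rewrite indicE memNset ?scale0r//= => -[_ /esym/eqP]; rewrite (negbTE ii).
elim: (index_enum I) => [|i r IH].
  exists (cst 0); first by exists 0 => s t *; rewrite subrr normr0 mul0r.
  by apply: aeW => s _; rewrite big_nil; exact: is_derive_cst.
apply: (@eq_has_primitive _ _ (fun s =>
    \1_(`]p, q[%classic `&` i_ @^-1` [set i]) s *: v i +
    \sum_(j <- r) \1_(`]p, q[%classic `&` i_ @^-1` [set j]) s *: v j)).
  by move=> s _; rewrite big_cons.
by apply: has_primitiveD => //; exact: has_primitive_indic.
Qed.

End measurable_controls.

(** * Measurable rounding to finite nets of compact sets *)

Section nets.
Context {R : realType} {n : nat}.
Local Notation U := 'rV[R]_n.

Lemma measurable_borel_ball (c : U) (e : R) :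
  measurable ([set u | `|c - u| < e] : set (borel_rV R n)).
Proof.
apply: sub_sigma_algebra => /=; rewrite (_ : [set u | _] = ball c e).
  exact: ball_open.
by rewrite -ball_normE.
Qed.

Lemma measurable_find (l : seq U) (e : R) (k : nat) :
  measurable ([set u | find (fun c => `|c - u| < e) l = k] : set (borel_rV R n)).
Proof.
elim: l k => [|c l IH] k /=.
  have [->|k0] := eqVneq k 0%N.
    by rewrite (_ : mkset _ = setT)//; apply/seteqP.
  rewrite (_ : mkset _ = set0)//; apply/seteqP; split => // u /= /esym/eqP.
  by rewrite (negbTE k0).
have mc := measurable_borel_ball c e.
case: k => [|k].
  rewrite (_ : mkset _ = [set u | `|c - u| < e])//.
  by apply/seteqP; split => u /=; case: ifP.
rewrite (_ : mkset _ = ~` [set u | `|c - u| < e] `&`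
   [set u | find (fun c => `|c - u| < e) l = k]).
  by apply: measurableI => //; exact: measurableC.
apply/seteqP; split => u /=; first by case: ifP => // _ [].
by move=> [/negP/negbTE -> ->].
Qed.

(** A point is rounded to the first centre of a finite cover whose ball contains it; taking the
    first one makes each cell a finite Boolean combination of balls, hence Borel. *)
Lemma compact_finite_net (K : set U) (e : R) : K !=set0 -> compact K -> 0 < e ->
  exists (I : finType) (i_ : U -> I) (c : I -> U),
    [/\ forall i, K (c i), forall u, K u -> `|u - c (i_ u)| <= e &
        forall i, measurable (i_ @^-1` [set i] : set (borel_rV R n))].
Proof.
move=> [u0 Ku0] cK e0.
have : exists l : seq U, (forall c, c \in l -> K c) /\
    forall u, K u -> exists2 c, c \in l & `|c - u| < e.
  move: cK; rewrite compact_cover => /(_ U K (fun c => ball c e)).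
  case=> [c _|u Ku|D DK KD]; [exact: ball_open|by exists u => //; exact: ballxx|].
  exists (finmap.enum_fset D); split => [c /DK|u /KD[c /= cD]]; first by rewrite inE.
  by rewrite -ball_normE/= => cu; exists c.
move=> [l [lK lcov]].
pose j u := find (fun c => `|c - u| < e) l.
have jl u : (j u < (size l).+1)%N by rewrite ltnS find_size.
(* The extra index is the value of [find] outside all balls; the default [u0] keeps its centre in
   [K]. *)
exists 'I_(size l).+1, (fun u => Ordinal (jl u)).
exists (fun i : 'I_(size l).+1 => nth u0 l i); split.
- move=> i; have [il|li] := ltnP i (size l); first by apply: lK; rewrite mem_nth.
  by rewrite nth_default.
- move=> u Ku; have [c cl cu] := lcov u Ku; rewrite distrC ltW//=.
  apply: (@nth_find _ u0 (fun c => `|c - u| < e)).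
  by apply/hasP; exists c.
- move=> i; rewrite (_ : _ @^-1` _ = [set u | j u = i]); first exact: measurable_find.
  by apply/seteqP; split => u /=; [case=> <-|move=> ji; apply/val_inj].
Qed.

End nets.

Section existence.
Context {R : realType}.
Local Notation mu := (@lebesgue_measure R).

Lemma measurable_lebesgueR_itv (a b : itv_bound R) :
  measurable ([set` Interval a b] : set (lebesgueR R)).
Proof. by apply: measurable_lebesgueR; exact: measurable_itv. Qed.

Lemma controls_preimage n (U : set 'rV[R]_n) T u (Y : set 'rV[R]_n) :
  controls U T u -> measurable (Y : set (borel_rV R n)) ->
  measurable (`]0, T[%classic `&` u @^-1` Y : set (lebesgueR R)).
Proof.
by move=> [_ mu_] mY; apply: mu_ => //; exact: measurable_lebesgueR_itv.
Qed.

Lemma measurable_truncn (T e : R) (k : nat) : 0 < e ->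
  measurable (`]0, T[%classic `&` [set s : R | Num.truncn (s / e) = k] : set (lebesgueR R)).
Proof.
move=> e0.
rewrite (_ : _ `&` _ = `]0, T[%classic `&` `[k%:R * e, k.+1%:R * e[%classic).
  by apply: measurableI; exact: measurable_lebesgueR_itv.
apply/seteqP; split => s /=; rewrite !in_itv/= => -[/andP[s0 sT]].
  have se0 : 0 <= s / e by rewrite divr_ge0// ltW.
  move=> /eqP; rewrite truncn_eq//.
  by rewrite ler_pdivlMr// ltr_pdivrMr// s0 sT.
rewrite -ler_pdivlMr// -ltr_pdivrMr// => H; split; first by rewrite s0.
by apply/eqP; rewrite truncn_eq// divr_ge0// ltW.
Qed.

Context {d nA nB : nat}.
Local Notation V := 'rV[R]_d.

Definition lipschitz3 (A : set 'rV[R]_nA) (B : set 'rV[R]_nB) (L : R)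
    (f : V -> 'rV[R]_nA -> 'rV[R]_nB -> V) :=
  forall x x' a a' b b', A a -> A a' -> B b -> B b' ->
    `|f x a b - f x' a' b'| <= L * (`|x - x'| + `|a - a'| + `|b - b'|).

Variables (A : set 'rV[R]_nA) (B : set 'rV[R]_nB) (L T : R).
Variable (f : V -> 'rV[R]_nA -> 'rV[R]_nB -> V).
Hypotheses (L0 : 0 < L) (T0 : 0 < T) (fL : lipschitz3 A B L f).
Hypotheses (A0 : A !=set0) (Ac : compact A) (B0 : B !=set0) (Bc : compact B).

(* Rounding time, a and b to finite nets gives integrands with finitely many
   values that are uniformly close to the original one. *)
Lemma has_primitive_dynamics a b y : controls A T a -> controls B T b ->
  lipschitz_itv 0 T y -> has_primitive 0 T (fun s => f (y s) (a s) (b s)).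
Proof.
move=> ca cb [k ylip]; apply: has_primitive_limit; first exact: ltW.
move=> e e0.
(* Three roundings (time, [a], [b]), each costing [L * e1 = e / 3]. The time mesh [eta] below is
   such that [y] moves by at most [e1] in a cell; [+ 1] avoids a division by zero. *)
pose e1 := e / (3 * L).
have e10 : 0 < e1 by rewrite divr_gt0// mulr_gt0.
have [I [i_ [cA [cAA cAe mi]]]] := compact_finite_net A0 Ac e10.
have [J [j_ [cB [cBB cBe mj]]]] := compact_finite_net B0 Bc e10.
pose eta := e1 / (`|k| + 1).
have k1 : 0 < `|k| + 1 by rewrite ltr_wpDl.
have eta0 : 0 < eta by rewrite divr_gt0.
pose M := (Num.truncn (T / eta)).+1.
pose ix s : 'I_M * I * J := (inord (Num.truncn (s / eta)), i_ (a s), j_ (b s)).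
pose v (i : 'I_M * I * J) := f (y (i.1.1%:R * eta)) (cA i.1.2) (cB i.2).
exists (fun s => v (ix s)).
  apply: (has_primitive_fin v); first exact: ltW.
  move=> [[m i] j].
  rewrite (_ : _ `&` _ = (`]0, T[%classic `&` [set s : R | Num.truncn (s / eta) = m]) `&`
    (`]0, T[%classic `&` a @^-1` (i_ @^-1` [set i])) `&`
    (`]0, T[%classic `&` b @^-1` (j_ @^-1` [set j]))).
    apply: measurableI; [apply: measurableI|].
    - exact: measurable_truncn.
    - exact: controls_preimage ca (mi i).
    - exact: controls_preimage cb (mj j).
  have truncM s : 0 < s < T -> (Num.truncn (s / eta) < M)%N.
    by move=> /andP[s0 sT]; rewrite ltnS le_truncn// ler_pM2r ?invr_gt0// ltW.
  apply/funext => s; apply/propext; split => /=; rewrite !in_itv/=.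
    move=> [sT [ms ias jbs]]; do !split => //.
    by rewrite -ms inordK// truncM.
  move=> [[[sT ms] [_ ias]] [_ jbs]]; split => //.
  by rewrite /ix ias jbs ms inord_val.
move=> s sT; have [s0 sT'] := andP sT.
have tr := truncn_itv (divr_ge0 (ltW s0) (ltW eta0)).
have sM : (Num.truncn (s / eta) < M)%N.
  by rewrite ltnS le_truncn// ler_pM2r ?invr_gt0// ltW.
rewrite /v /ix/= inordK//.
move: tr; set m := Num.truncn _; rewrite ler_pdivlMr// ltr_pdivrMr// => /andP[ms sm].
have cAs : A (a s) by apply: ca.1.
have cBs : B (b s) by apply: cb.1.
apply: le_trans (fL _ _ cAs (cAA _) cBs (cBB _)) _.
have -> : e = L * (e1 + e1 + e1) by rewrite /e1; field; rewrite gt_eqF.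
rewrite ler_pM2l// !lerD ?cAe ?cBe//.
have meta0 : 0 <= m%:R * eta by rewrite mulr_ge0// ltW.
apply: le_trans (ylip _ _ meta0 ms (ltW sT')) _.
have -> : e1 = (`|k| + 1) * eta by rewrite /eta mulrC divfK// gt_eqF.
apply: (@le_trans _ _ (`|k| * (s - m%:R * eta))).
  by rewrite ler_wpM2r ?subr_ge0// ler_norm.
apply: ler_pM => //; rewrite ?subr_ge0// ?lerDl//.
by move: sm; rewrite -natr1 mulrDl mul1r; lra.
Qed.

(** [trajectory] is a choice with default [cst x]; existence of a solution shows that the default is
    not what is chosen. *)
Lemma trajectory_solution a b x : controls A T a -> controls B T b ->
  caratheodory_solution f T a b x (trajectory f T a b x).
Proof.
move=> ca cb.
have [s z z' sT|y|y [y0 yac yd]] :=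
    @picard R d (fun s y => f y (a s) (b s)) 0 T x L (ltW T0) L0.
- have Aa : A (a s) by exact: ca.1.
  have Bb : B (b s) by exact: cb.1.
  by have := fL z z' Aa Aa Bb Bb; rewrite !subrr !normr0 !addr0.
- exact: has_primitive_dynamics.
by apply: (@xgetPex _ (cst x)); exists y; split.
Qed.

End existence.

(** * Trajectories of the game *)

Section game.
Context {R : realType} {d nA nB : nat}.
Local Notation mu := (@lebesgue_measure R).
Local Notation V := 'rV[R]_d.
Variables (A : set 'rV[R]_nA) (B : set 'rV[R]_nB) (L M T : R).
Variables (f : V -> 'rV[R]_nA -> 'rV[R]_nB -> V).
Variables (f1 : V -> 'rV[R]_nA -> V) (f2 : V -> 'rV[R]_nB -> V).
Variables (g phi : V -> R).

Record game_data : Prop := GameData {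
  gd_L : 0 < L; gd_M : 0 < M; gd_T : 0 < T;
  gd_A0 : A !=set0; gd_Ac : compact A; gd_B0 : B !=set0; gd_Bc : compact B;
  gd_f : forall x a b, A a -> B b -> f x a b = f1 x a + f2 x b;
  gd_f1L : forall x x' a a', A a -> A a' ->
    `|f1 x a - f1 x' a'| <= L * (`|x - x'| + `|a - a'|);
  gd_f2L : forall x x' b b', B b -> B b' ->
    `|f2 x b - f2 x' b'| <= L * (`|x - x'| + `|b - b'|);
  gd_f1M : forall x a, A a -> `|f1 x a| <= M * (1 + `|x|);
  gd_f2M : forall x b, B b -> `|f2 x b| <= M * (1 + `|x|);
  gd_cvx1 : forall x u v t, (f1 x @` A) u -> (f1 x @` A) v -> 0 <= t <= 1 ->
    (f1 x @` A) (t *: u + (1 - t) *: v);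
  gd_cvx2 : forall x u v t, (f2 x @` B) u -> (f2 x @` B) v -> 0 <= t <= 1 ->
    (f2 x @` B) (t *: u + (1 - t) *: v);
  gd_g : forall x x', `|g x - g x'| <= L * `|x - x'|;
  gd_phi : forall x x', `|phi x - phi x'| <= L * `|x - x'| }.

Hypothesis G : game_data.
Let L0 := gd_L G.
Let M0 := gd_M G.
Let T0 := gd_T G.

Lemma dynamics_lipschitz3 : lipschitz3 A B (2 * L) f.
Proof.
move=> x x' a a' b b' Aa Aa' Bb Bb'; rewrite !(gd_f G)//.
have -> : f1 x a + f2 x b - (f1 x' a' + f2 x' b') =
  (f1 x a - f1 x' a') + (f2 x b - f2 x' b') by apply/rowP => i; rewrite !mxE; ring.
apply: le_trans (ler_normD _ _) _.
apply: le_trans (lerD (gd_f1L G _ _ Aa Aa') (gd_f2L G _ _ Bb Bb')) _.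
rewrite -mulrDr -mulrA (mulrCA 2) ler_pM2l//.
have := normr_ge0 (a - a'); have := normr_ge0 (b - b'); lra.
Qed.

(* Gronwall gives 1 + |y| <= growth * (1 + |x|) along a trajectory y from x, so
   rho x bounds its speed; the + 1 makes rho x >= 1. *)
Definition growth := 1 + 2 * (1 + 2 * M * T) * expR (4 * M * T).
Definition speed := 2 * M * growth + 1.
Definition rho (x : V) := speed * (1 + `|x|).

Lemma growth_ge1 : 1 <= growth.
Proof.
rewrite lerDl mulr_ge0 ?expR_ge0// mulr_ge0// addr_ge0// !mulr_ge0//; exact: ltW.
Qed.

Lemma speed_ge1 : 1 <= speed.
Proof.
by rewrite lerDr !mulr_ge0 ?(ltW M0)// (le_trans _ growth_ge1).
Qed.

Lemma rho_ge1 x : 1 <= rho x.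
Proof.
by rewrite -[leLHS]mulr1 ler_pM ?speed_ge1// lerDl.
Qed.

Lemma growth_rho x : 2 * M * (growth * (1 + `|x|)) <= rho x.
Proof. by rewrite mulrA ler_wpM2r ?lerDl// addr_ge0. Qed.

Section trajectories.
Variables (a : R -> 'rV[R]_nA) (b : R -> 'rV[R]_nB) (x : V).
Hypotheses (ca : controls A T a) (cb : controls B T b).
Let y := trajectory f T a b x.

Lemma dynamics_lip_gt0 : 0 < 2 * L. Proof. by rewrite mulr_gt0. Qed.

Lemma trajectoryP : caratheodory_solution f T a b x y.
Proof.
exact: (trajectory_solution dynamics_lip_gt0 T0 dynamics_lipschitz3 (gd_A0 G) (gd_Ac G)
  (gd_B0 G) (gd_Bc G) x ca cb).
Qed.

Lemma dynamics_growth s z : 0 < s < T -> `|f z (a s) (b s)| <= 2 * M * (1 + `|z|).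
Proof.
move=> sT; have As : A (a s) by exact: ca.1.
have Bs : B (b s) by exact: cb.1.
rewrite (gd_f G)//; apply: le_trans (ler_normD _ _) _.
by apply: le_trans (lerD (gd_f1M G _ As) (gd_f2M G _ Bs)) _; lra.
Qed.

Lemma trajectory_bound s : 0 <= s <= T -> 1 + `|y s| <= growth * (1 + `|x|).
Proof.
move=> sT; have [y0 yac yd] := trajectoryP.
have M20 : 0 < 2 * M by rewrite mulr_gt0.
have H : {ae mu, forall s, 0 < s < T ->
     exists2 dw, is_derive s (1 : R) y dw & `|dw| <= 2 * M + 2 * M * `|y s|}.
  apply: ae_imply yd => t Ht tT; have dy := Ht tT.
  exists (f (y t) (a t) (b t)); first exact: dy.
  by apply: le_trans (dynamics_growth _ tT) _; rewrite mulrDr mulr1.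
have := gronwall (ltW T0) (ltW M20) M20 yac H sT.
rewrite y0 !subr0 => ys.
have : 2 * (`|x| + 2 * M * T) * expR (2 * (2 * M) * s) <=
       2 * (`|x| + 2 * M * T) * expR (4 * M * T).
  have MT0 : 0 <= 2 * M * T by rewrite mulr_ge0// ltW.
  rewrite ler_wpM2l ?mulr_ge0 ?addr_ge0// ler_expR.
  have -> : 2 * (2 * M) * s = 4 * M * s by ring.
  by rewrite ler_wpM2l ?mulr_ge0 ?(ltW M0)//; case/andP: sT.
move=> /(le_trans ys) {}ys.
rewrite /growth; set e := expR _ in ys *.
have e0 : 0 <= e by exact: expR_ge0.
have MT0 : 0 <= 2 * M * T by rewrite mulr_ge0// ltW.
have x0 := normr_ge0 x.
have : 0 <= 2 * e * (1 + 2 * M * T * `|x|) by rewrite !mulr_ge0// addr_ge0// mulr_ge0.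
have -> : (1 + 2 * (1 + 2 * M * T) * e) * (1 + `|x|) =
   1 + `|x| + 2 * (`|x| + 2 * M * T) * e + 2 * e * (1 + 2 * M * T * `|x|) by ring.
lra.
Qed.

Lemma trajectory_lipschitz s t : 0 <= s -> s <= t -> t <= T ->
  `|y t - y s| <= rho x * (t - s).
Proof.
have [y0 yac yd] := trajectoryP.
apply: increment_le_of_deriv => //; first by rewrite (le_trans _ (rho_ge1 x)).
apply: ae_imply yd => r Hr rT; have dy := Hr rT.
exists (f (y r) (a r) (b r)); first exact: dy.
apply: le_trans (dynamics_growth _ rT) _; apply: le_trans (growth_rho x).
rewrite ler_wpM2l ?mulr_ge0 ?(ltW M0)// trajectory_bound//.
by case/andP: rT => *; rewrite !ltW.
Qed.

Lemma trajectory_f1 s a' : 0 <= s <= T -> A a' -> `|f1 (y s) a'| <= rho x.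
Proof.
move=> sT Aa'; apply: le_trans (gd_f1M G _ Aa') _.
apply: le_trans (growth_rho x).
have : M * (1 + `|y s|) <= M * (growth * (1 + `|x|)).
  by rewrite ler_pM2l// trajectory_bound.
have : 0 <= M * (1 + `|y s|) by rewrite mulr_ge0 ?(ltW M0)// addr_ge0.
have -> : 2 * M * (growth * (1 + `|x|)) =
  M * (growth * (1 + `|x|)) + M * (growth * (1 + `|x|)) by ring.
lra.
Qed.

(* Over a time step the velocities stay O(step) away from the convex set of
   velocities frozen at the initial state of the step. *)
Lemma step_in_convex (K : set V) (u v : R) : 0 <= u -> u < v -> v <= T ->
  (forall z w t, K z -> K w -> 0 <= t <= 1 -> K (t *: z + (1 - t) *: w)) ->
  K !=set0 ->
  (forall s, u < s < v -> K (f (y u) (a s) (b s))) ->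
  exists2 k, K k & `|y v - y u - (v - u) *: k| <= 3 * L * rho x * (v - u) ^+ 2.
Proof.
move=> u0 uv vT Kcvx K0 KK; have [y0 yac yd] := trajectoryP.
have r0 : 0 < rho x by rewrite (lt_le_trans _ (rho_ge1 x)).
have vu0 : 0 < v - u by rewrite subr_gt0.
pose c := 2 * L * rho x * (v - u).
have c0 : 0 <= c by rewrite ltW// (mulr_gt0 (mulr_gt0 dynamics_lip_gt0 r0) vu0).
(* The drift of the velocity contributes [c * (v - u)], that is [2 * L * rho x * (v - u) ^+ 2]; this
   positive slack makes it [3 * L]. *)
pose eps := L * rho x * (v - u) ^+ 2.
have eps0 : 0 < eps by exact: mulr_gt0 (mulr_gt0 L0 r0) (exprn_gt0 2 vu0).
have [||k Kk Hk] := @increment_in_convex R d u v y (fun s => c * s) K eps (ltW uv)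
   (abs_continuousW u0 vT yac) _ Kcvx K0 _ eps0.
- by move=> s t _ st _; rewrite ler_wpM2l.
- apply: ae_imply yd => s Hs /andP[us sv].
  have sT : 0 < s < T by rewrite (le_lt_trans u0 us) (lt_le_trans sv vT).
  have dy := Hs sT.
  exists (f (y s) (a s) (b s)), c, (f (y u) (a s) (b s)); split.
  + exact: dy.
  + by apply: is_derive_eq; rewrite /GRing.scale/= mulr1.
  + by apply: KK; rewrite us sv.
  + have As : A (a s) by exact: ca.1.
    have Bs : B (b s) by exact: cb.1.
    apply: le_trans (dynamics_lipschitz3 _ _ As As Bs Bs) _.
    rewrite !subrr !normr0 !addr0 /c -(mulrA (2 * L)) ler_pM2l ?mulr_gt0//.
    apply: le_trans (trajectory_lipschitz u0 (ltW us) (ltW (lt_le_trans sv vT))) _.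
    by rewrite ler_pM2l// lerB// ltW.
exists k => //; apply: le_trans Hk _.
rewrite /c /eps le_eqVlt; apply/orP; left; apply/eqP; ring.
Qed.

Lemma step_select_a (u v : R) (b0 : 'rV[R]_nB) : 0 <= u -> u < v -> v <= T -> B b0 ->
  (forall s, u < s < v -> b s = b0) ->
  exists a0, A a0 /\
    `|y v - y u - (v - u) *: f (y u) a0 b0| <= 3 * L * rho x * (v - u) ^+ 2.
Proof.
move=> u0 uv vT Bb0 bb0; have [a1 Aa1] := gd_A0 G.
have [||s|k [a0 Aa0 <-] Hk] := @step_in_convex
  [set f1 (y u) a0 + f2 (y u) b0 | a0 in A] u v u0 uv vT.
- move=> _ _ t [z1 Az1 <-] [z2 Az2 <-] t01.
  have [z3 Az3 E] := gd_cvx1 G (imageP (f1 (y u)) Az1) (imageP (f1 (y u)) Az2) t01.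
  by exists z3 => //; rewrite E; apply/rowP => i; rewrite !mxE; ring.
- by exists (f1 (y u) a1 + f2 (y u) b0), a1.
- move=> /[dup] /bb0 -> /andP[us sv].
  have As : A (a s) by apply: ca.1; rewrite (le_lt_trans u0 us) (lt_le_trans sv vT).
  by exists (a s) => //; rewrite (gd_f G).
- by exists a0; rewrite (gd_f G).
Qed.

(** The velocity is left split because the delayed comparison treats its [f1] and [f2] parts
    separately. *)
Lemma step_select_b (u v : R) (a0 : 'rV[R]_nA) : 0 <= u -> u < v -> v <= T -> A a0 ->
  (forall s, u < s < v -> a s = a0) ->
  exists b0, B b0 /\
    `|y v - y u - (v - u) *: (f1 (y u) a0 + f2 (y u) b0)| <=
      3 * L * rho x * (v - u) ^+ 2.
Proof.
move=> u0 uv vT Aa0 aa0; have [b1 Bb1] := gd_B0 G.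
have [||s|k [b0 Bb0 <-] Hk] := @step_in_convex
  [set f1 (y u) a0 + f2 (y u) b0 | b0 in B] u v u0 uv vT.
- move=> _ _ t [z1 Bz1 <-] [z2 Bz2 <-] t01.
  have [z3 Bz3 E] := gd_cvx2 G (imageP (f2 (y u)) Bz1) (imageP (f2 (y u)) Bz2) t01.
  by exists z3 => //; rewrite E; apply/rowP => i; rewrite !mxE; ring.
- by exists (f1 (y u) a0 + f2 (y u) b1), b1.
- move=> /[dup] /aa0 -> /andP[us sv].
  have Bs : B (b s) by apply: cb.1; rewrite (le_lt_trans u0 us) (lt_le_trans sv vT).
  by exists (b s) => //; rewrite (gd_f G).
- by exists b0.
Qed.

End trajectories.

(** Causality of the dynamics: choices based on the state at time [t] use the controls only up to
    [t] and up to null sets. This is the source of non-anticipativity in both constructions. *)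
Lemma trajectory_local a a' b b' x t : controls A T a -> controls A T a' ->
  controls B T b -> controls B T b' -> 0 <= t <= T ->
  ae_eq_on t a a' -> ae_eq_on t b b' ->
  forall s, 0 <= s <= t -> trajectory f T a b x s = trajectory f T a' b' x s.
Proof.
move=> ca ca' cb cb' /andP[t0 tT] aa' bb'.
have [y0 yac yd] := trajectoryP x ca cb.
have [y0' yac' yd'] := trajectoryP x ca' cb'.
apply: (@ode_unique _ _ (fun s z => f z (a s) (b s)) _ _ _ _ _ t0 dynamics_lip_gt0).
- move=> s z z' /andP[s0 st].
  have sT : 0 < s < T by rewrite s0 (lt_le_trans st).
  have As : A (a s) by exact: ca.1.
  have Bs : B (b s) by exact: cb.1.
  have := dynamics_lipschitz3 z z' As As Bs Bs.
  by rewrite !subrr !normr0 !addr0.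
- exact: abs_continuousW yac.
- exact: abs_continuousW yac'.
- by rewrite y0 y0'.
- apply: ae_imply yd => s Hs /andP[s0 st].
  by apply: Hs; rewrite s0 (lt_le_trans st).
- apply: ae_imply (ae_conj (ae_conj aa' bb') yd') => s [[Ha Hb] Hs] /andP[s0 st].
  rewrite Ha ?Hb ?(ltW s0) ?(ltW st)//.
  by apply: Hs; rewrite s0 (lt_le_trans st).
Qed.

End game.

(** * Comparison on the time grid *)

Section time_grid.
Context {R : realType}.
Variables (T : R) (N : nat).
Hypotheses (T0 : 0 < T) (N0 : (0 < N)%N).
Local Notation tau := (T / N%:R).

Lemma tau_gt0 : 0 < tau.
Proof. by rewrite divr_gt0// ltr0n. Qed.

Lemma grid_last : N%:R * tau = T.
Proof. by rewrite mulrC divfK// pnatr_eq0 -lt0n. Qed.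

Lemma grid_le (k : nat) : (k <= N)%N -> k%:R * tau <= T.
Proof. by move=> kN; rewrite -[leRHS]grid_last ler_pM2r ?tau_gt0// ler_nat. Qed.

Lemma grid_truncn (k : nat) (s : R) : k%:R * tau <= s < k.+1%:R * tau ->
  Num.truncn (s / tau) = k.
Proof.
rewrite -ler_pdivlMr ?tau_gt0// -ltr_pdivrMr ?tau_gt0// => H.
exact: truncn_def.
Qed.

Lemma truncn_grid (s : R) : 0 <= s -> s < T ->
  [/\ (Num.truncn (s / tau) < N)%N, (Num.truncn (s / tau))%:R * tau <= s &
      s < (Num.truncn (s / tau)).+1%:R * tau].
Proof.
move=> s0 sT.
have /truncn_itv/andP[H1 H2] : 0 <= s / tau by rewrite divr_ge0// ltW// tau_gt0.
rewrite ler_pdivlMr ?tau_gt0// in H1; rewrite ltr_pdivrMr ?tau_gt0// in H2.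
split=> //; rewrite -(ltr_nat R) -(ltr_pM2r tau_gt0) grid_last.
exact: le_lt_trans H1 sT.
Qed.

Lemma grid_controls n (U : set 'rV[R]_n) (u : nat -> 'rV[R]_n) :
  (forall k, U (u k)) -> controls U T (fun s => u (Num.truncn (s / tau))).
Proof.
move=> Uu; split=> [s _|_ Y mY]; first exact: Uu.
rewrite (_ : _ `&` _ = \bigcup_(k in [set k : nat | Y (u k)])
   (`]0, T[%classic `&` [set s : R | Num.truncn (s / tau) = k])).
  by apply: bigcup_measurable => k _; apply: measurable_truncn; exact: tau_gt0.
apply/funext => s; apply/propext; split => /=.
  by move=> [sT Ys]; exists (Num.truncn (s / tau)).
by move=> [k Yk [sT sk]]; rewrite sk.
Qed.

End time_grid.

Section discrete_gronwall.
Context {R : realType} {d nA nB : nat}.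
Local Notation V := 'rV[R]_d.
Variables (f : V -> 'rV[R]_nA -> 'rV[R]_nB -> V) (A : set 'rV[R]_nA) (B : set 'rV[R]_nB).
Variables (L : R) (L0 : 0 <= L) (fL : lipschitz3 A B L f).

(** Each step multiplies the error by at most [1 + tau * L] and adds [tau * E1]; the power is
    bounded by an exponential. The initial error [E0] is there for the delayed scheme, which starts
    at a shifted point. *)
Lemma euler_error (tau E0 E1 : R) (N : nat) (w X : nat -> V)
    (a : nat -> 'rV[R]_nA) (b : nat -> 'rV[R]_nB) :
  0 <= tau -> 0 <= E0 -> 0 <= E1 ->
  (forall k, (k < N)%N -> A (a k)) -> (forall k, (k < N)%N -> B (b k)) ->
  `|w 0%N - X 0%N| <= E0 ->
  (forall k, (k < N)%N ->
     `|w k.+1 - w k - tau *: f (w k) (a k) (b k)| <= tau * E1) ->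
  (forall k, (k < N)%N -> X k.+1 = X k + tau *: f (X k) (a k) (b k)) ->
  forall k, (k <= N)%N ->
    `|w k - X k| <= (E0 + N%:R * tau * E1) * expR (L * (N%:R * tau)).
Proof.
move=> tau0 E00 E10 Aa Bb w0 wk Xk.
have q1 : 1 <= 1 + tau * L by rewrite lerDl mulr_ge0.
have q0 : 0 <= 1 + tau * L by apply: le_trans q1.
have main k : (k <= N)%N ->
    `|w k - X k| <= (E0 + k%:R * tau * E1) * (1 + tau * L) ^+ k.
  elim: k => [|k IH] kN; first by rewrite !mul0r addr0 expr0 mulr1.
  have -> : w k.+1 - X k.+1 = (w k.+1 - w k - tau *: f (w k) (a k) (b k)) +
      (w k - X k) + tau *: (f (w k) (a k) (b k) - f (X k) (a k) (b k)).
    by rewrite Xk//; apply/rowP => i; rewrite !mxE; ring.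
  apply: le_trans (ler_normD _ _) _.
  have A1 := ler_normD (w k.+1 - w k - tau *: f (w k) (a k) (b k)) (w k - X k).
  have A2 := wk _ kN.
  have A3 : `|tau *: (f (w k) (a k) (b k) - f (X k) (a k) (b k))| <=
            tau * L * `|w k - X k|.
    rewrite normrZ ger0_norm// -mulrA ler_wpM2l//.
    have := fL (w k) (X k) (Aa _ kN) (Aa _ kN) (Bb _ kN) (Bb _ kN).
    by rewrite !subrr !normr0 !addr0.
  have := ler_wpM2r q0 (IH (ltnW kN)); rewrite -[leRHS]mulrA -exprSr => A4.
  have A5 : tau * E1 <= tau * E1 * (1 + tau * L) ^+ k.+1.
    by rewrite ler_peMr ?mulr_ge0// exprn_ege1.
  have -> : (E0 + k.+1%:R * tau * E1) * (1 + tau * L) ^+ k.+1 =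
    (E0 + k%:R * tau * E1) * (1 + tau * L) ^+ k.+1 + tau * E1 * (1 + tau * L) ^+ k.+1.
    by rewrite -natr1; ring.
  lra.
move=> k kN; apply: le_trans (main k kN) _.
apply: ler_pM.
- by rewrite addr_ge0// !mulr_ge0.
- by rewrite exprn_ge0.
- by rewrite lerD2l ler_wpM2r// ler_wpM2r// ler_nat.
- apply: (@le_trans _ _ (expR (tau * L) ^+ k)).
    by rewrite lerXn2r// ?nnegrE ?expR_ge0// expR_ge1Dx.
  rewrite -expRM_natl ler_expR.
  have -> : k%:R * (tau * L) = L * (k%:R * tau) by ring.
  rewrite ler_wpM2l//.
  by rewrite ler_wpM2r// ler_nat.
Qed.

End discrete_gronwall.

Section payoffs.
Context {R : realType} {d nA nB : nat}.
Local Notation V := 'rV[R]_d.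
Variables (T L r E : R) (N : nat) (g phi : V -> R) (y : R -> V) (X : nat -> V).
Hypotheses (T0 : 0 < T) (N0 : (0 < N)%N) (L0 : 0 <= L).
Hypothesis gL : forall x x', `|g x - g x'| <= L * `|x - x'|.
Hypothesis phiL : forall x x', `|phi x - phi x'| <= L * `|x - x'|.
Local Notation tau := (T / N%:R).
Hypothesis yr : forall s t, 0 <= s -> s <= t -> t <= T -> `|y t - y s| <= r * (t - s).
Hypothesis r0 : 0 <= r.
Hypothesis yX : forall k, (k <= N)%N -> `|y (k%:R * tau) - X k| <= E.

Let err := L * (E + r * tau).
Let dpay := maxe (\big[maxe/-oo%E]_(k < N) (g (X k))%:E) (phi (X N))%:E.

Let tau0 := tau_gt0 T0 N0.

Lemma state_close k s : (k < N)%N -> k%:R * tau <= s -> s <= k.+1%:R * tau ->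
  `|y s - X k| <= E + r * tau.
Proof.
move=> kN ks sk.
have -> : y s - X k = (y (k%:R * tau) - X k) + (y s - y (k%:R * tau)).
  by rewrite [RHS]addrC addrA subrK.
apply: le_trans (ler_normD _ _) _; rewrite lerD ?yX 1?ltnW//.
apply: le_trans (yr _ ks _) _.
- by rewrite mulr_ge0// ltW.
- by rewrite (le_trans sk)// grid_le.
- by rewrite ler_wpM2l// lerBlDl; move: sk; rewrite -natr1 mulrDl mul1r.
Qed.

Lemma terminal_close : `|y T - X N| <= E + r * tau.
Proof.
by have := yX (leqnn N); rewrite grid_last// => /le_trans; apply;
  rewrite lerDl mulr_ge0// ltW.
Qed.

Lemma payoff_le : (payoff g phi T y <= dpay + err%:E)%E.
Proof.
rewrite /payoff ge_max; apply/andP; split.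
  apply: ge_ereal_sup => _ [s /= + <-]; rewrite in_itv/= => /andP[s0 sT].
  have [kN ks sk] := truncn_grid T0 N0 (ltW s0) sT.
  set k := Num.truncn _ in kN ks sk.
  apply: (@le_trans _ _ ((g (X k))%:E + err%:E)%E).
    rewrite -EFinD lee_fin.
    have := gL (y s) (X k); have := ler_norm (g (y s) - g (X k)).
    have : L * `|y s - X k| <= err by rewrite ler_wpM2l// state_close// ltW.
    lra.
  rewrite leeD2r// le_max; apply/orP; left.
  exact: (le_bigmax -oo%E (fun i : 'I_N => (g (X i))%:E) (Ordinal kN)).
apply: (@le_trans _ _ ((phi (X N))%:E + err%:E)%E).
  rewrite -EFinD lee_fin.
  have := phiL (y T) (X N); have := ler_norm (phi (y T) - phi (X N)).
  have : L * `|y T - X N| <= err by rewrite ler_wpM2l// terminal_close.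
  lra.
by rewrite leeD2r// le_max lexx orbT.
Qed.

Lemma dpayoff_le : (dpay <= payoff g phi T y + err%:E)%E.
Proof.
rewrite /dpay ge_max; apply/andP; split.
  apply/bigmax_leP; split => [|k _]; first exact: leNye.
  (* The running cost is a supremum over the open interval, which misses the grid time 0; the middle
     of the step replaces it. *)
  pose s := k%:R * tau + tau / 2.
  have tau2 : 0 < tau / 2 by rewrite divr_gt0.
  have sk : s < k.+1%:R * tau.
    by rewrite /s -[k.+1%:R]natr1 mulrDl mul1r ltrD2l; move: tau0; lra.
  have k0 : 0 <= k%:R * tau by rewrite mulr_ge0// ltW.
  have sT : 0 < s < T.
    apply/andP; split; first by rewrite /s; lra.
    by rewrite (lt_le_trans sk)// grid_le.
  apply: (@le_trans _ _ ((g (y s))%:E + err%:E)%E).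
    rewrite -EFinD lee_fin.
    have := gL (X k) (y s); have := ler_norm (g (X k) - g (y s)).
    have : L * `|X k - y s| <= err.
      by rewrite ler_wpM2l// distrC state_close ?(ltW sk)// lerDl ltW.
    lra.
  rewrite leeD2r// le_max; apply/orP; left.
  by apply: ereal_sup_ubound; exists s => //=; rewrite in_itv.
apply: (@le_trans _ _ ((phi (y T))%:E + err%:E)%E).
  rewrite -EFinD lee_fin.
  have := phiL (X N) (y T); have := ler_norm (phi (X N) - phi (y T)).
  have : L * `|X N - y T| <= err by rewrite ler_wpM2l// distrC terminal_close.
  lra.
by rewrite leeD2r// le_max lexx orbT.
Qed.

End payoffs.

(** * Comparison of the strategies *)

Section strategies_comparison.
Context {R : realType} {d nA nB : nat}.
Local Notation mu := (@lebesgue_measure R).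
Local Notation V := 'rV[R]_d.
Variables (A : set 'rV[R]_nA) (B : set 'rV[R]_nB) (L M T : R).
Variables (f : V -> 'rV[R]_nA -> 'rV[R]_nB -> V).
Variables (f1 : V -> 'rV[R]_nA -> V) (f2 : V -> 'rV[R]_nB -> V).
Variables (g phi : V -> R).
Hypothesis G : game_data A B L M T f f1 f2 g phi.
Variables (N : nat) (x : V).
Hypothesis N0 : (0 < N)%N.
Local Notation tau := (T / N%:R).
Let L0 := gd_L G.
Let T0 := gd_T G.
Let tau0 := tau_gt0 T0 N0.
Let r1 := rho_ge1 G x.
Local Notation r := (rho M T x).
Let r0 : 0 < r := lt_le_trans ltr01 r1.
Let fL := dynamics_lipschitz3 G.
Local Notation F := (fun y a b => y + tau *: f y a b).

(** Inside the exponential factor, 1 stands for the initial shift [tau * r] and [6 * L * T] for the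
    local errors: [3 + 2 + 1] with the delay, [3 + 2] with the rounding. The outer 2 counts the
    return from [w] to [y] and the motion within a step. The leading [L] is the Lipschitz constant
    of the costs. *)
Definition error_const := L * (2 + (1 + 6 * L * T) * expR (2 * L * T)).

Lemma grid_step (k : nat) : (k < N)%N ->
  [/\ 0 <= k%:R * tau, k%:R * tau < k.+1%:R * tau, k.+1%:R * tau <= T &
      k.+1%:R * tau - k%:R * tau = tau].
Proof.
move=> kN; split.
- by rewrite mulr_ge0// ltW.
- by rewrite ltr_pM2r// ltr_nat.
- exact: grid_le.
- by rewrite -natr1; ring.
Qed.

Lemma error_bound_le (E0 E1 : R) : E0 <= tau * r -> E1 <= 6 * L * r * tau ->
  L * ((E0 + N%:R * tau * E1) * expR (2 * L * (N%:R * tau)) + r * tau + r * tau)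
    <= error_const * r * tau.
Proof.
move=> H0 H1; rewrite grid_last// /error_const -!(mulrA L) ler_pM2l//.
have e0 := expR_gt0 (2 * L * T).
have : T * E1 <= T * (6 * L * r * tau) by rewrite ler_pM2l.
move=> H2; have H3 := lerD H0 H2.
have : (E0 + T * E1) * expR (2 * L * T) <=
    (tau * r + T * (6 * L * r * tau)) * expR (2 * L * T).
  by rewrite ler_pM2r.
have -> : (2 + (1 + 6 * L * T) * expR (2 * L * T)) * r * tau =
  (tau * r + T * (6 * L * r * tau)) * expR (2 * L * T) + r * tau + r * tau by ring.
by move=> H4; rewrite !lerD2r.
Qed.

(* The discrete strategy sees b only through its rounding to a finite net of B,
   so it takes finitely many values on measurable pieces. *)
Lemma discretize_strategy alpha : strategies A B T alpha ->
  exists2 beta, dstrategies A B (N := N) beta & forall b, dcontrols B (N := N) b ->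
    exists2 b', controls B T b' &
      (dpayoff F g phi x (beta b) b <=
       payoff g phi T (trajectory f T (alpha b') b' x) +
       (error_const * r * tau)%:E)%E.
Proof.
move=> [alphaA alphaN].
(* A net of radius [tau] changes velocities by [O(tau)], the order of the error already made on a
   step. *)
have [I [i_ [c [cB ce mi]]]] := compact_finite_net (gd_B0 G) (gd_Bc G) tau0.
have [b0 Bb0] := gd_B0 G; have [a0 Aa0] := gd_A0 G.
pose rb (w : {ffun 'I_N -> I}) (k : nat) := if insub k is Some j then c (w j) else b0.
have rbE w (j : 'I_N) : rb w j = c (w j) by rewrite /rb valK.
have Brb w k : B (rb w k) by rewrite /rb; case: insub.
pose bc w (s : R) := rb w (Num.truncn (s / tau)).
have cbc w : controls B T (bc w) by exact: grid_controls.
have cac w : controls A T (alpha (bc w)) by exact: alphaA.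
pose y w := trajectory f T (alpha (bc w)) (bc w) x.
pose t (k : nat) := k%:R * tau.
(* The candidates depend on [w] only through [rb w k] and the states at [t k] and [t k.+1]. As
   [xget] is a function of the set, equal data give equal answers, which makes the selection
   non-anticipative. *)
pose sel w k := [set a | A a /\ `|y w (t k.+1) - y w (t k) -
  tau *: f (y w (t k)) a (rb w k)| <= 3 * L * r * tau ^+ 2].
have selP w k : (k < N)%N -> sel w k (xget a0 (sel w k)).
  move=> kN; apply: xgetPex.
  have [tk0 tk1 tkT tkE] := grid_step kN.
  have [|a [Aa Ha]] := step_select_a G x (cac w) (cbc w) tk0 tk1 tkT (Brb w k).
    move=> s /andP[ks sk]; rewrite /bc (grid_truncn T0 N0 (k := k))//.
    by rewrite (ltW ks).
  by exists a; split => //; rewrite tkE in Ha.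
have y_local (w w' : {ffun 'I_N -> I}) (k : 'I_N) :
    (forall i : 'I_N, (i <= k)%N -> w i = w' i) ->
    forall s, 0 <= s <= t k.+1 -> y w s = y w' s.
  move=> ww'; have [_ _ tkT _] := grid_step (ltn_ord k).
  have t01 : 0 <= t k.+1 <= T by rewrite tkT mulr_ge0// ltW.
  have bb' : ae_eq_on (t k.+1) (bc w) (bc w').
    (* At [t k.+1] itself the control already shows its next value; this single time is
       negligible. *)
    apply: ae_imply (ae_neq (t k.+1)) => s st /andP[s0 sle].
    have slt : s < t k.+1 by rewrite lt_neqAle st.
    have [sN ts _] := truncn_grid T0 N0 s0 (lt_le_trans slt tkT).
    have sk : (Num.truncn (s / tau) <= k)%N.
      by rewrite -ltnS -(ltr_nat R) -(ltr_pM2r tau0); exact: le_lt_trans ts slt.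
    by rewrite /bc (rbE w (Ordinal sN)) (rbE w' (Ordinal sN)) ww'.
  apply: (trajectory_local G) => //; exact: alphaN.
pose Psi w : N.-tuple 'rV[R]_nA := [tuple xget a0 (sel w k) | k < N].
pose W (b : N.-tuple 'rV[R]_nB) : {ffun 'I_N -> I} := [ffun k => i_ (tnth b k)].
exists (Psi \o W).
  split.
  - by move=> b _ k; rewrite /= tnth_mktuple; have [] := selP (W b) k (ltn_ord k).
  - move=> mD Y mY.
    rewrite (_ : _ @^-1` _ = \bigcup_(w in [set w | Y (Psi w)])
       \bigcap_(k in [set: 'I_N])
         ((fun b : N.-tuple 'rV[R]_nB => tnth b k) @^-1` (i_ @^-1` [set w k]))).
      apply: measurableI => //; apply: fin_bigcup_measurable => // w _.
      apply: fin_bigcap_measurable => // k _.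
      have := @measurable_tnth _ (borel_rV R nB) N k.
      move=> /(_ measurableT _ (mi (w k))); rewrite setTI; exact.
    apply/funext => b; apply/propext; split => /=.
      by move=> Yb; exists (W b) => // k _ /=; rewrite ffunE.
    move=> [w Yw Hw]; suff <- : w = W b by [].
    by apply/ffunP => k; rewrite ffunE; exact/esym/(Hw k Logic.I).
  - move=> k b b' _ _ bb'; rewrite /= !tnth_mktuple.
    have WW (i : 'I_N) : (i <= k)%N -> W b i = W b' i by move=> ik; rewrite !ffunE bb'.
    have [tk0 tk1 _ _] := grid_step (ltn_ord k).
    have E1 : y (W b) (t k.+1) = y (W b') (t k.+1).
      by apply: (y_local _ _ k WW); rewrite lexx ltW// (le_lt_trans tk0).
    have E2 : y (W b) (t k) = y (W b') (t k).
      by apply: (y_local _ _ k WW); rewrite /t tk0 ltW.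
    by congr xget; rewrite /sel E1 E2 !rbE WW.
move=> b Bb; exists (bc (W b)) => //.
pose w := W b.
apply: (@le_trans _ _ (payoff g phi T (y w) + (L * ((0 + N%:R * tau * (6 * L * r * tau)) *
   expR (2 * L * (N%:R * tau)) + r * tau))%:E)%E); last first.
  rewrite leeD2l// lee_fin; apply: le_trans (@error_bound_le 0 _ _ (lexx _)).
    by rewrite ler_pM2l// lerDl mulr_ge0// ltW.
  by rewrite mulr_ge0// ltW.
rewrite /dpayoff.
apply: (@dpayoff_le _ _ T L r _ N g phi (y w)
   (dtrajectory F x (Psi w) b) T0 N0 (ltW L0) (gd_g G) (gd_phi G)).
- exact: (trajectory_lipschitz G x (cac w) (cbc w)).
- exact: ltW.
have wN k : (k < N)%N -> nth 0 (Psi w) k = xget a0 (sel w k).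
  by move=> kN; rewrite -(tnth_nth 0 _ (Ordinal kN)) tnth_mktuple.
have bN k (kN : (k < N)%N) : nth 0 b k = tnth b (Ordinal kN) by rewrite (tnth_nth 0).
apply: (@euler_error _ _ _ _ f A B (2 * L) _ fL tau 0 (6 * L * r * tau) N
  (fun k => y w (k%:R * tau)) _ (fun k => nth 0 (Psi w) k) (fun k => nth 0 b k)) => //.
- exact: ltW (dynamics_lip_gt0 G).
- exact: ltW.
- by rewrite ltW// mulr_gt0// mulr_gt0// mulr_gt0.
- by move=> k kN; rewrite wN//; case: (selP w k kN).
- by move=> k kN; rewrite bN; exact: Bb.
- rewrite mul0r /= /y; have [-> _ _] := trajectoryP G x (cac w) (cbc w).
  by rewrite subrr normr0.
move=> k kN; have [Aak Hk] := selP w k kN.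
rewrite wN//; set a := xget _ _ in Aak Hk *.
have -> : y w (k.+1%:R * tau) - y w (k%:R * tau) -
    tau *: f (y w (k%:R * tau)) a (nth 0 b k) =
  (y w (t k.+1) - y w (t k) - tau *: f (y w (t k)) a (rb w k)) +
   tau *: (f (y w (t k)) a (rb w k) - f (y w (t k)) a (nth 0 b k)).
  by apply/rowP => i; rewrite !mxE /t; ring.
apply: le_trans (ler_normD _ _) _.
have bb : `|rb w k - nth 0 b k| <= tau.
  by rewrite bN (rbE w (Ordinal kN)) ffunE distrC ce.
have H1 : `|tau *: (f (y w (t k)) a (rb w k) - f (y w (t k)) a (nth 0 b k))| <=
    tau * (2 * L * tau).
  rewrite normrZ ger0_norm ?(ltW tau0)// ler_pM2l//.
  have Bnb : B (nth 0 b k) by rewrite bN; exact: Bb.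
  apply: le_trans (fL _ _ Aak Aak (Brb w k) Bnb) _.
  by rewrite !subrr !normr0 !add0r ler_pM2l// (dynamics_lip_gt0 G).
(* [1 <= r] absorbs the rounding error, which carries no factor [r], into the common bound. *)
have H2 : tau * (2 * L * tau) * 1 <= tau * (2 * L * tau) * r.
  by rewrite (ler_pM2l (mulr_gt0 tau0 (mulr_gt0 (dynamics_lip_gt0 G) tau0))).
rewrite mulr1 in H2.
have H3 : 0 < L * r * tau ^+ 2 by exact: mulr_gt0 (mulr_gt0 L0 r0) (exprn_gt0 2 tau0).
have E1 : tau * (2 * L * tau) * r = 2 * (L * r * tau ^+ 2) by ring.
have E2 : tau * (6 * L * r * tau) = 6 * (L * r * tau ^+ 2) by ring.
have E3 : 3 * L * r * tau ^+ 2 = 3 * (L * r * tau ^+ 2) by ring.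
rewrite E2; rewrite E3 in Hk; rewrite E1 in H2; lra.
Qed.

(* The continuous player answers with a delay of one step, which keeps the
   strategy non-anticipative; since f is a sum, the shift of a only perturbs
   the Euler scheme through its first value, w = y + tau f1(y, a_{k-1}). *)
Lemma delay_strategy beta : dstrategies A B (N := N) beta ->
  exists2 alpha, strategies A B T alpha & forall b, controls B T b ->
    exists2 b', dcontrols B (N := N) b' &
      (payoff g phi T (trajectory f T (alpha b) b x) <=
       dpayoff F g phi x (beta b') b' + (error_const * r * tau)%:E)%E.
Proof.
move=> [betaA _ betaN].
have [b0 Bb0] := gd_B0 G; have [a0 Aa0] := gd_A0 G.
pose tup (be : nat -> 'rV[R]_nB) : N.-tuple 'rV[R]_nB := [tuple be i | i < N].
(* The delayed answer: [a0] on the first step, then entry [k - 1] of the answer of [beta].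
   Non-anticipativity of [beta] makes the tail of [be] from index [k] on irrelevant to [del be k],
   so provisional tails are harmless. *)
pose del (be : nat -> 'rV[R]_nB) k := if k is k'.+1 then nth a0 (beta (tup be)) k' else a0.
pose ac be (s : R) := del be (Num.truncn (s / tau)).
have tupB be : (forall k, B (be k)) -> dcontrols B (tup be).
  by move=> Bbe k; rewrite tnth_mktuple.
have delA be k : (forall k, B (be k)) -> A (del be k).
  move=> Bbe; case: k => [//|k] /=; have [kN|Nk] := ltnP k N; last first.
    by rewrite nth_default ?size_tuple.
  by rewrite -(tnth_nth _ _ (Ordinal kN)); exact/betaA/tupB.
have cac be : (forall k, B (be k)) -> controls A T (ac be).
  by move=> Bbe; apply: grid_controls => // k; exact: delA.
have del_local be be' k : (forall k, B (be k)) -> (forall k, B (be' k)) ->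
    (forall i, (i < k)%N -> be i = be' i) -> del be k = del be' k.
  case: k => [//|k] Bbe Bbe' bb /=; have [kN|Nk] := ltnP k N; last first.
    by rewrite !nth_default ?size_tuple.
  rewrite -!(tnth_nth _ _ (Ordinal kN)); apply: betaN; [exact: tupB|exact: tupB|].
  by move=> i ik; rewrite !tnth_mktuple bb.
pose t (k : nat) := k%:R * tau.
pose y be b := trajectory f T (ac be) b x.
pose sel be b k := [set z | B z /\ `|y be b (t k.+1) - y be b (t k) -
  tau *: (f1 (y be b (t k)) (del be k) + f2 (y be b (t k)) z)| <= 3 * L * r * tau ^+ 2].
have selP be b k : (forall k, B (be k)) -> controls B T b -> (k < N)%N ->
    sel be b k (xget b0 (sel be b k)).
  move=> Bbe cb kN; apply: xgetPex.
  have [tk0 tk1 tkT tkE] := grid_step kN.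
  have [|z [Bz Hz]] := step_select_b G x (cac be Bbe) cb tk0 tk1 tkT (delA be k Bbe).
    move=> s /andP[ks sk]; rewrite /ac (grid_truncn T0 N0 (k := k))//.
    by rewrite (ltW ks).
  by exists z; split => //; rewrite tkE in Hz.
(* [bs b k] has its first [k] entries determined and the tail [b0]. There is no circularity:
   selecting entry [k] needs the trajectory up to [t k.+1], and the delayed control driving it there
   uses only the entries before [k]. *)
pose bs := fix bs (b : R -> 'rV[R]_nB) (k : nat) : nat -> 'rV[R]_nB :=
  if k is k'.+1 then
    fun i => if i == k' then xget b0 (sel (bs b k') b k') else bs b k' i
  else cst b0.
have bsS b k : bs b k.+1 =
  fun i => if i == k then xget b0 (sel (bs b k) b k) else bs b k i by [].
have xgetB be b k : B (xget b0 (sel be b k)).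
  by case: xgetP => [z -> []|].
have Bbs b k i : B (bs b k i).
  by elim: k i => [//|k IH] i; rewrite bsS; case: eqP.
have bs_stable b k m i : (i < k)%N -> (k <= m)%N -> bs b m i = bs b k i.
  move=> ik; elim: m => [|m IH]; first by rewrite leqn0 => /eqP k0; rewrite k0 in ik.
  rewrite leq_eqVlt ltnS => /predU1P[->//|km]; rewrite bsS IH//.
  by rewrite (ltn_eqF (leq_trans ik km)).
(* Before [t k.+1] the step index is at most [k], so only entries below [k] are read, and these no
   longer change after stage [k]. *)
have ac_local b k m s : (k <= m)%N -> 0 <= s -> s < t k.+1 ->
    (k < N)%N -> ac (bs b m) s = ac (bs b k) s.
  move=> km s0 sk kN; rewrite /ac.
  have [_ _ tkT _] := grid_step kN.
  have [sN ts _] := truncn_grid T0 N0 s0 (lt_le_trans sk tkT).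
  have sk' : (Num.truncn (s / tau) <= k)%N.
    by rewrite -ltnS -(ltr_nat R) -(ltr_pM2r tau0); exact: le_lt_trans ts sk.
  apply: del_local => // i ii; apply: bs_stable => //; exact: leq_trans ii sk'.
have ae_lt be be' k : (forall s, 0 <= s -> s < t k -> ac be s = ac be' s) ->
    ae_eq_on (t k) (ac be) (ac be').
  move=> H; apply: ae_imply (ae_neq (t k)) => s st /andP[s0 sle].
  by apply: H => //; rewrite lt_neqAle st.
have tT k : (k <= N)%N -> 0 <= t k <= T.
  by move=> kN; rewrite mulr_ge0 ?(ltW tau0)//= grid_le.
(* The first [k] entries depend on [b] only through its class on [[0, t k]]: each new entry is read
   from states reached by then. *)
have bs_local tt b b' k : controls B T b -> controls B T b' -> (k <= N)%N ->
    t k <= tt -> ae_eq_on tt b b' -> bs b k = bs b' k.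
  move=> cb cb' kN ktt bb'; elim: k kN ktt => [//|k IH] kN ktt.
  have tkk : t k < t k.+1 by have [] := grid_step kN.
  have E := IH (ltnW kN) (le_trans (ltW tkk) ktt).
  have ykk s : 0 <= s <= t k.+1 -> y (bs b k) b s = y (bs b' k) b' s.
    rewrite E; apply: (trajectory_local G) => //; [exact: cac|exact: cac|exact: tT| |].
      by apply: aeW.
    apply: ae_imply bb' => z + /andP[z0 zk]; apply.
    by rewrite z0 (le_trans zk).
  have [tk0 _ _ _] := grid_step kN.
  have E1 : y (bs b k) b (t k.+1) = y (bs b' k) b' (t k.+1).
    by apply: ykk; rewrite lexx ltW// (le_lt_trans tk0).
  have E2 : y (bs b k) b (t k) = y (bs b' k) b' (t k).
    by apply: ykk; rewrite /t tk0 ltW.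
  have E3 : sel (bs b k) b k = sel (bs b' k) b' k by rewrite /sel E1 E2 E.
  by rewrite !bsS E3 -E.
exists (fun b => ac (bs b N)).
  split; first by move=> b cb; exact: cac.
  move=> tt /andP[tt0 ttT] b b' cb cb' bb'.
  (* [T] is removed so that the step index [k] stays below [N]. At time [s] the answer uses entries
     below [k], determined by [b] up to [t k <= s]. *)
  apply: ae_imply (ae_neq T) => s sT /andP[s0 stt].
  have sltT : s < T by rewrite lt_neqAle sT (le_trans stt).
  have [sN ts _] := truncn_grid T0 N0 s0 sltT.
  rewrite /ac; set k := Num.truncn _ in sN ts *.
  apply: del_local => // i ik.
  rewrite !(bs_stable _ k N i ik (ltnW sN)).
  by rewrite (bs_local tt b b' k) ?(ltnW sN)// (le_trans ts).
move=> b cb; pose be := bs b N.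
exists (tup be); first by apply: tupB => k; exact: Bbs.
have Bbe k : B (be k) by exact: Bbs.
pose Y := y be b.
have Ylip s s' : 0 <= s -> s <= s' -> s' <= T -> `|Y s' - Y s| <= r * (s' - s).
  exact: (trajectory_lipschitz G x (cac _ Bbe) cb).
(* Entry [k] was selected along the trajectory driven by [bs b k], not by the final [be]; thanks to
   the delay the two agree up to [t k.+1]. *)
have Yk k : (k < N)%N -> `|Y (t k.+1) - Y (t k) -
    tau *: (f1 (Y (t k)) (del be k) + f2 (Y (t k)) (be k))| <= 3 * L * r * tau ^+ 2.
  move=> kN.
  have bek : be k = xget b0 (sel (bs b k) b k).
    by rewrite /be (bs_stable b k.+1 N k)// bsS eqxx.
  have [_] := selP (bs b k) b k (Bbs b k) cb kN; rewrite -bek.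
  have dk : del (bs b k) k = del be k.
    apply: del_local => // i ik; rewrite /be (bs_stable b k N i)//; exact: ltnW.
  have yY s : 0 <= s <= t k.+1 -> y (bs b k) b s = Y s.
    apply: (trajectory_local G) => //; [exact: cac|exact: cac|exact: tT| |].
      by apply: ae_lt => z z0 zk; rewrite /be (ac_local b k N)// ltnW.
    by apply: aeW.
  have [tk0 tk1 _ _] := grid_step kN.
  have E1 : y (bs b k) b (t k.+1) = Y (t k.+1).
    by apply: yY; rewrite lexx ltW// (le_lt_trans tk0).
  have E2 : y (bs b k) b (t k) = Y (t k) by apply: yY; rewrite /t tk0 ltW.
  by rewrite E1 E2 dk.
(* From [w k] to [w k.+1] the outdated term in [del be k] cancels and the one in [del be k.+1], the
   discrete [a_k], enters next to [f2] at [be k]. *)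
pose w k := Y (t k) + tau *: f1 (Y (t k)) (del be k).
have f1Y k : (k <= N)%N -> `|f1 (Y (t k)) (del be k)| <= r.
  move=> kN; apply: (trajectory_f1 G x (cac _ Bbe) cb); first exact: tT.
  exact: delA.
have wY k : (k <= N)%N -> `|w k - Y (t k)| <= tau * r.
  by move=> kN; rewrite /w addrC addKr normrZ ger0_norm ?(ltW tau0)// ler_pM2l// f1Y.
pose X := dtrajectory F x (beta (tup be)) (tup be).
have aN k (kN : (k < N)%N) : nth 0 (beta (tup be)) k = del be k.+1.
  by rewrite /= -!(tnth_nth _ _ (Ordinal kN)).
have bN k (kN : (k < N)%N) : nth 0 (tup be) k = be k.
  by rewrite -(tnth_nth _ _ (Ordinal kN)) tnth_mktuple.
have wX k : (k <= N)%N ->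
    `|w k - X k| <= (tau * r + N%:R * tau * (6 * L * r * tau)) * expR (2 * L * (N%:R * tau)).
  apply: (@euler_error _ _ _ _ f A B (2 * L) _ fL tau (tau * r) (6 * L * r * tau) N
    w X (fun k => nth 0 (beta (tup be)) k) (fun k => nth 0 (tup be) k)) => //.
  - exact: ltW (dynamics_lip_gt0 G).
  - exact: ltW.
  - by rewrite ltW// mulr_gt0.
  - by rewrite ltW// mulr_gt0// mulr_gt0// mulr_gt0.
  - by move=> j jN; rewrite aN//; exact: delA.
  - by move=> j jN; rewrite bN.
  - have <- : Y (t 0%N) = X 0%N; last exact: wY.
    by rewrite /t mul0r /Y /y; have [-> _ _] := trajectoryP G x (cac be Bbe) cb.
  move=> j jN; rewrite aN// bN//.
  have Aj := delA be j.+1 Bbe; have Bj := Bbe j.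
  have [tj0 tj1 tjT tjE] := grid_step jN.
  have -> : w j.+1 - w j - tau *: f (w j) (del be j.+1) (be j) =
    (Y (t j.+1) - Y (t j) -
      tau *: (f1 (Y (t j)) (del be j) + f2 (Y (t j)) (be j))) +
    tau *: (f1 (Y (t j.+1)) (del be j.+1) - f1 (w j) (del be j.+1)) +
    tau *: (f2 (Y (t j)) (be j) - f2 (w j) (be j)).
    by rewrite (gd_f G)// {1 2}/w; apply/rowP => i; rewrite !mxE; ring.
  apply: le_trans (ler_normD _ _) _.
  have N1 := ler_normD (Y (t j.+1) - Y (t j) -
      tau *: (f1 (Y (t j)) (del be j) + f2 (Y (t j)) (be j)))
    (tau *: (f1 (Y (t j.+1)) (del be j.+1) - f1 (w j) (del be j.+1))).
  have N2 := Yk j jN.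
  have tL0 : 0 < tau * L by rewrite mulr_gt0.
  have wYj := wY j (ltnW jN).
  have N3 : `|tau *: (f1 (Y (t j.+1)) (del be j.+1) - f1 (w j) (del be j.+1))| <=
      tau * L * (2 * (tau * r)).
    rewrite normrZ ger0_norm ?(ltW tau0)// -mulrA ler_pM2l//.
    apply: le_trans (gd_f1L G _ _ Aj Aj) _; rewrite subrr normr0 addr0 ler_pM2l//.
    have -> : Y (t j.+1) - w j = (Y (t j.+1) - Y (t j)) - (w j - Y (t j)).
      by apply/rowP => i; rewrite !mxE; ring.
    apply: le_trans (ler_normB _ _) _.
    have := Ylip _ _ tj0 (ltW tj1) tjT; rewrite tjE -!/(t _); lra.
  have N4 : `|tau *: (f2 (Y (t j)) (be j) - f2 (w j) (be j))| <= tau * L * (tau * r).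
    rewrite normrZ ger0_norm ?(ltW tau0)// -mulrA ler_pM2l//.
    apply: le_trans (gd_f2L G _ _ Bj Bj) _.
    by rewrite subrr normr0 addr0 ler_pM2l// distrC.
  have E1 : tau * L * (2 * (tau * r)) = 2 * (L * r * tau ^+ 2) by ring.
  have E2 : tau * (6 * L * r * tau) = 6 * (L * r * tau ^+ 2) by ring.
  have E3 : 3 * L * r * tau ^+ 2 = 3 * (L * r * tau ^+ 2) by ring.
  have E4 : tau * L * (tau * r) = L * r * tau ^+ 2 by ring.
  rewrite E2; rewrite E3 in N2; rewrite E1 in N3; rewrite E4 in N4; lra.
(* The last [r * tau] is the distance from [w k] back to [Y (t k)]. *)
pose E := (tau * r + N%:R * tau * (6 * L * r * tau)) * expR (2 * L * (N%:R * tau)) + r * tau.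
apply: (@le_trans _ _ (dpayoff F g phi x (beta (tup be)) (tup be) +
    (L * (E + r * tau))%:E)%E); last first.
  rewrite leeD2l// lee_fin; exact: error_bound_le.
apply: (@payoff_le _ _ T L r E N g phi Y X T0 N0 (ltW L0) (gd_g G) (gd_phi G)).
- exact: Ylip.
- exact: ltW.
move=> k kN; have -> : Y (k%:R * tau) - X k = (w k - X k) - (w k - Y (t k)).
  by apply/rowP => i; rewrite !mxE /t; ring.
apply: le_trans (ler_normB _ _) _; apply: lerD; first exact: wX.
by rewrite (mulrC r); exact: wY.
Qed.

End strategies_comparison.

(** * Lipschitz constants, equivalence of norms, comparison of inf-sup values *)

Section preliminaries.
Context {R : realType}.

(** Every larger constant is allowed, so that one maximum can serve all the data. *)
Lemma lipschitz_constant (V W : normedModType R) (h : V -> W) (D : set V) :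
  [lipschitz h z | z in D] ->
  exists L0 : R, forall L, L0 <= L -> forall z z', D z -> D z' ->
    `|h z - h z'| <= L * `|z - z'|.
Proof.
move=> [K [_ HK]]; exists (K + 1) => L KL z z' Dz Dz'.
have KL' : K < L by rewrite (lt_le_trans _ KL)// ltrDl.
exact: (HK L KL' (z, z') (conj Dz Dz')).
Qed.

Lemma norm_pair_le (V W : normedModType R) (z z' : V * W) :
  `|z - z'| <= `|z.1 - z'.1| + `|z.2 - z'.2|.
Proof. by rewrite [leLHS]/Num.norm/= ge_max lerDl lerDr !normr_ge0. Qed.

Lemma convex_set_comb (V : lmodType R) (K : set V) : convex_set K ->
  forall u v (t : R), K u -> K v -> 0 <= t <= 1 -> K (t *: u + (1 - t) *: v).
Proof.
move=> Kc u v t Ku Kv /andP[t0 t1].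
by have := Kc u v (Itv01 t0 t1); rewrite !inE; exact.
Qed.

Lemma mx_coord_norm n (x : 'rV[R]_n) i : `|x ord0 i| <= `|x|.
Proof.
rewrite [leRHS]/Num.norm /= mx_normrE.
exact: (le_bigmax 0 (fun ij : 'I_1 * 'I_n => `|x ij.1 ij.2|) (ord0, i)).
Qed.

(** [p] is continuous, being bounded by a multiple of the sup norm, so it attains a positive minimum
    on the compact unit sphere; homogeneity extends the bound. This direction replaces [|x|] by
    [nrm x] in the final estimate. *)
Lemma norm_equivalence n (p : 'rV[R]_n -> R) : is_norm p ->
  exists2 c, 0 < c & forall x, `|x| <= c * p x.
Proof.
move=> [pD pZ p0].
have p00 : p 0 = 0 by have := pZ 0 0; rewrite scale0r normr0 mul0r.
have pN x : p (- x) = p x by have := pZ (-1) x; rewrite scaleN1r normrN1 mul1r.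
have pge0 x : 0 <= p x by have := pD x (- x); rewrite subrr p00 pN; lra.
pose C := \sum_(i < n) p (delta_mx 0 i).
have C0 : 0 <= C by exact: sumr_ge0.
have pC x : p x <= C * `|x|.
  rewrite {1}(row_sum_delta x) /C mulr_suml.
  elim/big_rec2 : _ => [|i u v _ uv]; first by rewrite p00.
  apply: le_trans (pD _ _) _; apply: lerD => //.
  by rewrite pZ mulrC ler_wpM2l// mx_coord_norm.
have pcont : continuous p.
  move=> x; apply/(cvgrPdist_le (FF := nbhs_filter x)) => e e0.
  apply/nbhs_ballP; exists (e / (C + 1)); first by rewrite /= divr_gt0// ltr_wpDl.
  move=> z; rewrite -ball_normE /= => /ltW zx.
  have zx' : C * `|x - z| <= e.
    apply: (@le_trans _ _ ((C + 1) * `|x - z|)); first by rewrite ler_wpM2r// lerDl.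
    by rewrite mulrC -ler_pdivlMr// ltr_wpDl.
  have H1 := pD (x - z) z; have H2 := pD (z - x) x.
  rewrite !subrK in H1 H2.
  have H3 := pC (x - z); have H4 := pC (z - x); rewrite distrC in H4.
  by rewrite ler_norml; lra.
pose S := [set x : 'rV[R]_n | `|x| = 1].
have cS : compact S.
  apply: bounded_closed_compact.
    exists 1; split => // M M1 x /= ->; exact: ltW.
  have -> : S = (fun x : 'rV[R]_n => `|x|) @^-1` [set 1] by [].
  apply: closed_comp; first by move=> x _; exact: norm_continuous.
  exact: closed_eq.
have [S0|/set0P/negP/negPn/eqP S0] := pselect (S !=set0).
  have [x0 Sx0 minx0] := compact_EVT_min S0 cS (continuous_subspaceT pcont).
  rewrite inE /S /= in Sx0.
  have px0 : 0 < p x0.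
    rewrite lt_neqAle pge0 andbT eq_sym; apply/eqP => /p0 x00.
    by move: Sx0; rewrite x00 normr0 => /esym/eqP; rewrite oner_eq0.
  exists (p x0)^-1; first by rewrite invr_gt0.
  move=> x; have [->|x_neq0] := eqVneq x 0; first by rewrite normr0 p00 mulr0.
  have nx : 0 < `|x| by rewrite normr_gt0.
  have : p x0 <= p (`|x|^-1 *: x).
    apply: minx0; rewrite inE /S /= normrZ ger0_norm ?invr_ge0// mulVf//.
    by rewrite gt_eqF.
  rewrite pZ ger0_norm ?invr_ge0// ler_pdivlMl// => H.
  by rewrite ler_pdivlMl// mulrC.
(* The sphere is empty, as in dimension 0: a nonzero vector could be normalised into it. *)
exists 1 => // x; have [->|x_neq0] := eqVneq x 0; first by rewrite normr0 p00 mulr0.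
have nx : 0 < `|x| by rewrite normr_gt0.
suff : S (`|x|^-1 *: x) by rewrite S0.
by rewrite /S /= normrZ ger0_norm ?invr_ge0// mulVf// gt_eqF.
Qed.

Local Open Scope ereal_scope.

(** Transferring strategies one way and opposing controls back compares the values without any
    optimal strategy. *)
Lemma inf_sup_le_err (X1 Y1 X2 Y2 : Type) (S1 : set X1) (B1 : set Y1)
    (S2 : set X2) (B2 : set Y2) (p1 : X1 -> Y1 -> \bar R) (p2 : X2 -> Y2 -> \bar R)
    (e : R) :
  (forall al, S2 al -> exists2 be, S1 be & forall b, B1 b ->
     exists2 b', B2 b' & p1 be b <= p2 al b' + e%:E) ->
  ereal_inf [set ereal_sup [set p1 be b | b in B1] | be in S1] <=
  ereal_inf [set ereal_sup [set p2 al b | b in B2] | al in S2] + e%:E.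
Proof.
move=> H; rewrite -leeBlDr//; apply: le_ereal_inf_tmp => z [al S2al <-].
have [be S1be Hbe] := H _ S2al; rewrite leeBlDr//.
apply: le_trans; first by apply: ereal_inf_lbound; exists be.
apply: ge_ereal_sup => w [b /Hbe[b' B2b' Hb] <-]; apply: (le_trans Hb).
by rewrite leeD2r//; apply: ereal_sup_ubound; exists b'.
Qed.

(** One-sided bounds alone do not suffice: they hold for [u = v = +oo], where [u - v] is infinite.
    Finiteness of [u] excludes this and forces that of [v]. *)
Lemma abse_sub_le (u v : \bar R) (c e : R) : - c%:E <= u -> u <= c%:E ->
  u <= v + e%:E -> v <= u + e%:E -> `| u - v | <= e%:E.
Proof.
case: u v => [u| |] [v| |]//= _ _; rewrite -?EFinD ?lee_fin// => uv vu.
by rewrite ler_norml; lra.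
Qed.

End preliminaries.

(** * Finiteness of the continuous value and the two-sided estimate *)

Section value_estimates.
Context {R : realType} {d nA nB : nat}.
Local Notation V := 'rV[R]_d.
Variables (A : set 'rV[R]_nA) (B : set 'rV[R]_nB) (L M T : R).
Variables (f : V -> 'rV[R]_nA -> 'rV[R]_nB -> V).
Variables (f1 : V -> 'rV[R]_nA -> V) (f2 : V -> 'rV[R]_nB -> V).
Variables (g phi : V -> R).
Hypothesis G : game_data A B L M T f f1 f2 g phi.

Lemma payoff_bounded x a b : controls A T a -> controls B T b ->
  let c := `|g 0| + `|phi 0| + L * (growth M T * (1 + `|x|)) in
  (- c%:E <= payoff g phi T (trajectory f T a b x))%E /\
  (payoff g phi T (trajectory f T a b x) <= c%:E)%E.
Proof.
move=> ca cb c; have L0 := gd_L G; have T0 := gd_T G.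
have yb s : 0 <= s <= T -> L * `|trajectory f T a b x s| <= L * (growth M T * (1 + `|x|)).
  move=> sT; rewrite ler_pM2l//.
  by have := trajectory_bound G x ca cb sT; lra.
have gb s : 0 <= s <= T -> `|g (trajectory f T a b x s)| <= c.
  move=> /yb H; have H1 := gd_g G (trajectory f T a b x s) 0; rewrite subr0 in H1.
  have H2 := ler_normD (g (trajectory f T a b x s) - g 0) (g 0); rewrite subrK in H2.
  by have := normr_ge0 (phi 0); rewrite /c; lra.
have pb : `|phi (trajectory f T a b x T)| <= c.
  have /yb H : 0 <= T <= T by rewrite lexx ltW.
  have H1 := gd_phi G (trajectory f T a b x T) 0; rewrite subr0 in H1.
  have H2 := ler_normD (phi (trajectory f T a b x T) - phi 0) (phi 0); rewrite subrK in H2.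
  by have := normr_ge0 (g 0); rewrite /c; lra.
split.
  rewrite /payoff le_max; apply/orP; right; rewrite -EFinN lee_fin.
  by move: pb; rewrite ler_norml => /andP[].
rewrite /payoff ge_max; apply/andP; split.
  apply: ge_ereal_sup => _ [s /= + <-]; rewrite in_itv/= => /andP[s0 sT].
  by rewrite lee_fin (le_trans (ler_norm _))// gb// !ltW.
by rewrite lee_fin (le_trans (ler_norm _)).
Qed.

(** Provides the finiteness required by [abse_sub_le]. The lower bound tests the supremum on a
    constant control, the upper bound tests the infimum on a constant strategy. *)
Lemma value_bounded x :
  let c := `|g 0| + `|phi 0| + L * (growth M T * (1 + `|x|)) in
  (- c%:E <= value f g phi A B T x)%E /\ (value f g phi A B T x <= c%:E)%E.
Proof.
move=> c; have [a0 Aa0] := gd_A0 G; have [b0 Bb0] := gd_B0 G.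
have ca : controls A T (cst a0) by split=> // *; exact: measurable_cst.
have cb : controls B T (cst b0) by split=> // *; exact: measurable_cst.
split.
  apply: le_ereal_inf_tmp => _ [al [alA _] <-].
  have := payoff_bounded x (alA _ cb) cb; rewrite -/c => -[H _].
  by apply: (le_trans H); apply: ereal_sup_ubound; exists (cst b0).
apply: (@le_trans _ _ (ereal_sup [set payoff g phi T (trajectory f T (cst a0) b x)
   | b in controls B T])).
  apply: ereal_inf_lbound; exists (fun=> cst a0) => //; split=> // t _ b b' _ _ _.
  exact: aeW.
apply: ge_ereal_sup => _ [b cb' <-].
by have [_] := payoff_bounded x ca cb'.
Qed.

Lemma value_dvalue_le (N : nat) (x : V) : (0 < N)%N ->
  (`| value f g phi A B T x -
      dvalue (fun y a b => (y + (T / N%:R) *: f y a b)%R) g phi A B N x |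
    <= (error_const L T * rho M T x * (T / N%:R))%:E)%E.
Proof.
move=> N0; have [H1 H2] := value_bounded x.
apply: abse_sub_le H1 H2 _ _; apply: inf_sup_le_err.
  by move=> be Hbe; exact: (delay_strategy G x N0 Hbe).
by move=> al Hal; exact: (discretize_strategy G x N0 Hal).
Qed.

End value_estimates.

Unset Implicit Arguments.

Theorem theorem2p7 (R : realType) (d nA nB : nat) (T : R)
    (nrm : 'rV[R]_d -> R) (A : set 'rV[R]_nA) (B : set 'rV[R]_nB)
    (f : 'rV[R]_d -> 'rV[R]_nA -> 'rV[R]_nB -> 'rV[R]_d)
    (g phi : 'rV[R]_d -> R)
    (f1 : 'rV[R]_d -> 'rV[R]_nA -> 'rV[R]_d)
    (f2 : 'rV[R]_d -> 'rV[R]_nB -> 'rV[R]_d)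
    (T_gt0 : 0 < T) (nA_gt0 : (0 < nA)%N) (nB_gt0 : (0 < nB)%N)
    (nrm_norm : is_norm nrm)
    (A_neq0 : A !=set0) (A_compact : compact A)
    (B_neq0 : B !=set0) (B_compact : compact B)
    (f_lip : [lipschitz f z.1.1 z.1.2 z.2
              | z in ([set: 'rV[R]_d] `*` A) `*` B])
    (g_lip : lipschitz (g : 'rV[R]_d -> R^o))
    (phi_lip : lipschitz (phi : 'rV[R]_d -> R^o))
    (f1_lip : [lipschitz f1 z.1 z.2 | z in [set: 'rV[R]_d] `*` A])
    (f2_lip : [lipschitz f2 z.1 z.2 | z in [set: 'rV[R]_d] `*` B])
    (f_split : forall x a b, A a -> B b -> f x a b = f1 x a + f2 x b)
    (f1_convex : forall x, convex_set (f1 x @` A))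
    (f2_convex : forall x, convex_set (f2 x @` B)) :
  exists2 C : R, 0 <= C &
    forall N : nat, (0 < N)%N -> forall x : 'rV[R]_d,
      let tau := T / N%:R in
      let F := fun y a b => y + tau *: f y a b in
      (`| value f g phi A B T x - dvalue F g phi A B N x |
         <= (C * (1 + nrm x) * tau)%:E)%E.
Proof.
have [Lg HLg] := lipschitz_constant g_lip.
have [Lp HLp] := lipschitz_constant phi_lip.
have [L1 HL1] := lipschitz_constant f1_lip.
have [L2 HL2] := lipschitz_constant f2_lip.
(* The 1 makes [L] positive, also when all the data are constant. *)
pose L := Num.max 1 (Num.max (Num.max Lg Lp) (Num.max L1 L2)).
have L0 : 0 < L by rewrite lt_max ltr01.
have Lge : [/\ Lg <= L, Lp <= L, L1 <= L & L2 <= L].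
  by rewrite /L !le_max !lexx /= !orbT.
have [LgL LpL L1L L2L] := Lge.
have f1L x x' a a' : A a -> A a' ->
    `|f1 x a - f1 x' a'| <= L * (`|x - x'| + `|a - a'|).
  move=> Aa Aa'; apply: le_trans (HL1 L L1L (x, a) (x', a') _ _) _ => //.
  by rewrite ler_pM2l// norm_pair_le.
have f2L x x' b b' : B b -> B b' ->
    `|f2 x b - f2 x' b'| <= L * (`|x - x'| + `|b - b'|).
  move=> Bb Bb'; apply: le_trans (HL2 L L2L (x, b) (x', b') _ _) _ => //.
  by rewrite ler_pM2l// norm_pair_le.
have bounded_on n (U : set 'rV[R]_n) : compact U ->
    exists2 K : R, 0 <= K & forall u, U u -> `|u| <= K.
  move=> /compact_bounded[K [_ HK]]; exists (`|K| + 1); first by rewrite addr_ge0.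
  by move=> u Uu; apply: (HK (`|K| + 1)) => //; rewrite (le_lt_trans (ler_norm K))// ltrDl.
have growthM n (U : set 'rV[R]_n) (h : 'rV[R]_d -> 'rV[R]_n -> 'rV[R]_d) :
    U !=set0 -> compact U ->
    (forall x x' u u', U u -> U u' -> `|h x u - h x' u'| <= L * (`|x - x'| + `|u - u'|)) ->
    exists2 M : R, 0 < M &
      forall M', M <= M' -> forall x u, U u -> `|h x u| <= M' * (1 + `|x|).
  move=> [u0 Uu0] /bounded_on[K K0 HK] hL.
  (* [2 * K] bounds the distance from [u] to [u0], and the summand [L] carries the growth in
     [|x|]. *)
  exists (`|h 0 u0| + L * (1 + 2 * K)).
    by rewrite ltr_wpDl// mulr_gt0// ltr_wpDr// mulr_ge0.
  move=> M' MM' x u Uu.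
  have H1 := hL x 0 u u0 Uu Uu0; rewrite subr0 in H1.
  have H2 := ler_normD (h x u - h 0 u0) (h 0 u0); rewrite subrK in H2.
  have H3 := ler_normB u u0; have H4 := HK _ Uu; have H5 := HK _ Uu0.
  have H6 : L * (`|x| + `|u - u0|) <= L * (`|x| + 2 * K) by rewrite ler_pM2l//; lra.
  have x0 := normr_ge0 x.
  have H7 : 0 <= L * (2 * K) * `|x| by rewrite !mulr_ge0// ltW.
  have H8 : 0 <= `|h 0 u0| * `|x| by rewrite mulr_ge0.
  apply: (@le_trans _ _ ((`|h 0 u0| + L * (1 + 2 * K)) * (1 + `|x|))); last first.
    by rewrite ler_wpM2r// addr_ge0.
  have -> : (`|h 0 u0| + L * (1 + 2 * K)) * (1 + `|x|) =
    `|h 0 u0| + L * (`|x| + 2 * K) + L + L * (2 * K) * `|x| + `|h 0 u0| * `|x| by ring.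
  lra.
have [M1 M10 HM1] := growthM _ _ _ A_neq0 A_compact f1L.
have [M2 M20 HM2] := growthM _ _ _ B_neq0 B_compact f2L.
pose M := Num.max M1 M2.
have M1M : M1 <= M by rewrite le_max lexx.
have M2M : M2 <= M by rewrite le_max lexx orbT.
have M0 : 0 < M by exact: lt_le_trans M10 M1M.
have G : game_data A B L M T f f1 f2 g phi.
  split => //.
  - exact: HM1.
  - exact: HM2.
  - by move=> x u v t; exact: (convex_set_comb (@f1_convex x)).
  - by move=> x u v t; exact: (convex_set_comb (@f2_convex x)).
  - by move=> x x'; exact: (HLg L LgL x x').
  - by move=> x x'; exact: (HLp L LpL x x').
have [c c0 Hc] := norm_equivalence nrm_norm.
(* [1 <= c1] and [c <= c1] together give [1 + |x| <= c1 * (1 + nrm x)]. *)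
pose c1 := Num.max 1 c.
have c10 : 0 <= c1 by rewrite le_max ler01.
have nrm0 x : 0 <= nrm x by have := le_trans (normr_ge0 x) (Hc x); rewrite pmulr_rge0.
have e0 : 0 <= error_const L T.
  rewrite mulr_ge0 ?(ltW L0)// addr_ge0// mulr_ge0 ?expR_ge0//.
  by rewrite addr_ge0// mulr_ge0 ?(ltW T_gt0)// mulr_ge0// ltW.
have s0 : 0 <= speed M T by exact: le_trans ler01 (speed_ge1 G).
exists (error_const L T * speed M T * c1); first exact: mulr_ge0 (mulr_ge0 e0 s0) c10.
move=> N N0 x /=; apply: le_trans (value_dvalue_le G x N0) _.
rewrite lee_fin ler_pM2r ?tau_gt0// /rho -!(mulrA (error_const _ _)) ler_wpM2l//.
rewrite -mulrA ler_wpM2l// mulrDr mulr1 lerD ?le_max ?lexx//.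
by apply: le_trans (Hc x) _; rewrite ler_wpM2r// le_max lexx orbT.
Qed.
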